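(* Let $k$ be a local Hausdorff ring with open unit group and $X$ a $k$-scheme of finite type. Then the fine topology on $X(k)$ coincides with the strong topology, and $k$ satisfies the following axioms for all $k$-schemes $X,Y,Z$ of finite type, with respect to the fine topology: (F1) for all $k$-morphisms $X\to Z$ and $Y\to Z$, the canonical bijection $(X\times_Z Y)(k)\to X(k)\times_{Z(k)}Y(k)$ is a homeomorphism; (F2) the canonical bijection $\mathbb{A}^1_k(k)\to k$ is a homeomorphism; (F3) a closed immersion $Y\to X$ of $k$-schemes yields a closed embedding $Y(k)\to X(k)$ of topological spaces; (F4) an open immersion $Y\to X$ of $k$-schemes yields an open embedding $Y(k)\to X(k)$ of topological spaces; (F5) if $\{U_i\}_{i\in I}$ is an affine open covering of $X$, then $X(k)=\bigcup_{i\in I}U_i(k)$, and a subset $W$ of $X(k)$ is open if and only if $W\cap U_i(k)$ is open in $U_i(k)$ for all $i\in I$.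
   Context: All rings are commutative with $1$. A local Hausdorff ring with open unit group is a local ring $k$ that is a Hausdorff topological ring such that $k^\times$ is open in $k$ and is a topological group in the subspace topology. For a $k$-scheme $X$, $X(k)$ is the set of $k$-morphisms $\mathrm{Spec}\,k\to X$. Fine topology: for an affine $k$-scheme $U=\mathrm{Spec}\,A$, the affine topology on $U(k)=\mathrm{Hom}_k(A,k)$ is the coarsest topology such that all evaluation maps $f\mapsto f(a)$, $a\in A$, are continuous. For an arbitrary $k$-scheme $X$, the fine topology on $X(k)$ is the finest topology such that for every $k$-morphism $\alpha:U\to X$ from an affine $k$-scheme $U$ the induced map $U(k)\to X(k)$ is continuous, where $U(k)$ carries the affine topology. Strong topology (for $X$ of finite type over $k$): if $X$ is a closed subscheme of $\mathbb{A}^n_k$, then $X(k)$ has the subspace topology from $\mathbb{A}^n(k)=k^n$; in general, for an affine open covering $\{U_i\}$ of $X$, $X(k)$ has the finest topology such that all inclusions $U_i(k)\to X(k)$ are continuous (this is independent of the choices). The fibre product $X(k)\times_{Z(k)}Y(k)$ carries the subspace topology of the product topology. *)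

(* Defs.v *)
(* Rings are `comPzRingType`: the zero ring has to be allowed, since it is the
   value of a sheaf of rings on the empty set. *)
From HB Require Import structures.
From mathcomp Require Import all_boot all_order all_algebra generic_quotient ring.
(* the notations of mpoly clash with those of MathComp-Analysis *)
From mathcomp Require Import (canonicals, coercions) mpoly.
From mathcomp Require Import all_classical topology tvs.

Set Implicit Arguments.
Unset Strict Implicit.
Unset Printing Implicit Defensive.

Import GRing.Theory.
Local Open Scope classical_set_scope.
Local Open Scope ring_scope.
Local Open Scope quotient_scope.

Definition is_unit (A : comPzRingType) (a : A) : Prop := exists b, a * b = 1.

Definition local_ring (A : comPzRingType) : Prop :=
  (1 : A) <> 0 /\ forall a b : A, is_unit (a + b) -> is_unit a \/ is_unit b.

Record opens (X : topologicalType) :=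
  Opens { opens_set :> set X ; opensP : open opens_set }.

Lemma opens_ext (X : topologicalType) (U V : opens X) :
  opens_set U = opens_set V -> U = V.
Proof.
by case: U V => [U oU] [V oV] /= eUV; subst V; congr Opens.
Qed.

Lemma preim_open (X Y : topologicalType) (f : X -> Y) (cf : continuous f)
  (V : opens Y) : open (f @^-1` V).
Proof. by move/continuousP: cf; apply; exact: opensP. Qed.

Definition preim (X Y : topologicalType) (f : X -> Y) (cf : continuous f)
  (V : opens Y) : opens X := Opens (preim_open cf V).

Record ringed_space := RingedSpace {
  rs_top :> topologicalType ;
  sec : opens rs_top -> comPzRingType ;
  res : forall U V : opens rs_top, V `<=` U -> {rmorphism sec U -> sec V} ;
  res_id : forall (U : opens rs_top) (h : U `<=` U) (s : sec U), res h s = s ;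
  res_comp : forall (U V W : opens rs_top) (h : V `<=` U) (h' : W `<=` V)
    (h'' : W `<=` U) (s : sec U), res h' (res h s) = res h'' s ;
  res_glue : forall (U : opens rs_top) (I : Type) (V : I -> opens rs_top)
    (hV : forall i, V i `<=` U) (s : forall i, sec (V i)),
    U `<=` \bigcup_i V i ->
    (forall i j (W : opens rs_top) (hi : W `<=` V i) (hj : W `<=` V j),
       res hi (s i) = res hj (s j)) ->
    exists! t : sec U, forall i, res (hV i) t = s i }.

Arguments sec {r} U.
Arguments res {r U V} h.

(* the germ of s at x is a unit of the stalk at x *)
Definition unit_at (X : ringed_space) (x : X) (U : opens X) (s : sec U) : Prop :=
  exists (V : opens X) (h : V `<=` U), opens_set V x /\ is_unit (res h s).

(* The last two fields spell out `local_ring` for the stalks: finitely many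
   germs at x have representatives on a common open neighbourhood of x, and
   1 <> 0 in the stalk iff 1 <> 0 on every such neighbourhood. *)
Record lrs := Lrs {
  lrs_rs :> ringed_space ;
  stalk_nontrivial : forall (x : lrs_rs) (U : opens lrs_rs), opens_set U x ->
    (1 : sec U) <> 0 ;
  stalk_local : forall (x : lrs_rs) (U : opens lrs_rs) (s t : sec U), opens_set U x ->
    unit_at x (s + t) -> unit_at x s \/ unit_at x t }.

Lemma preimS (X Y : topologicalType) (f : X -> Y) (cf : continuous f)
  (V W : opens Y) : W `<=` V -> preim cf W `<=` preim cf V.
Proof. by move=> WV x; exact: WV. Qed.

Record mor (X Y : lrs) := Mor {
  mor_fun :> X -> Y ;
  mor_cont : continuous mor_fun ;
  sharp : forall V : opens Y, {rmorphism sec V -> sec (preim mor_cont V)} ;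
  sharp_res : forall (V W : opens Y) (h : W `<=` V) (s : sec V),
    sharp W (res h s) = res (preimS (cf := mor_cont) h) (sharp V s) ;
  sharp_local : forall (x : X) (V : opens Y) (s : sec V), opens_set V (mor_fun x) ->
    unit_at x (sharp V s) -> unit_at (mor_fun x) s }.

Lemma rmorph_ext (A B : pzSemiRingType) (f g : {rmorphism A -> B}) :
  f =1 g -> f = g.
Proof.
case: f g => [f [[f1] [f2]]] [g [[g1] [g2]]] /= /funext efg.
by subst g; rewrite (Prop_irrelevance f1 g1) (Prop_irrelevance f2 g2).
Qed.

Lemma mor_ext (X Y : lrs) (f g : mor X Y) :
  (forall x, f x = g x) ->
  (forall (V : opens Y) (s : sec V) (U : opens X)
      (hf : U `<=` preim (@mor_cont _ _ f) V)
      (hg : U `<=` preim (@mor_cont _ _ g) V),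
      res hf (sharp f V s) = res hg (sharp g V s)) -> f = g.
Proof.
case: f g => [f cf f' fr fl] [g cg g' gr gl] /= /funext efg; subst g.
rewrite (Prop_irrelevance cg cf) in g' gr gl *.
move=> efg'; have eqs : f' = g'.
  apply: functional_extensionality_dep => V; apply: rmorph_ext => s.
  have := efg' V s (preim cf V) (fun=> id) (fun=> id).
  by rewrite !res_id.
subst g'; congr Mor; exact: Prop_irrelevance.
Qed.

Lemma unit_at_res (X : ringed_space) (x : X) (U V : opens X) (h : V `<=` U)
  (s : sec U) : unit_at x (res h s) -> unit_at x s.
Proof.
move=> [W [hW [Wx uW]]]; exists W, (subset_trans hW h); split => //.
by rewrite -(res_comp h hW).
Qed.

Lemma res_trans (X : ringed_space) (U V W : opens X) (h : V `<=` U)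
  (h' : W `<=` V) (s : sec U) : res h' (res h s) = res (subset_trans h' h) s.
Proof. exact: res_comp. Qed.

Lemma res_irr (X : ringed_space) (U V : opens X) (h h' : V `<=` U) (s : sec U) :
  res h s = res h' s.
Proof. by rewrite (Prop_irrelevance h h'). Qed.

Section IdComp.

Lemma id_cont (X : topologicalType) : continuous (@id X).
Proof. by move=> x. Qed.

Lemma id_preim (X : topologicalType) (V : opens X) :
  preim (@id_cont X) V `<=` V.
Proof. by []. Qed.

Lemma id_sharp_res (X : lrs) (V W : opens X) (h : W `<=` V) (s : sec V) :
  res (@id_preim X W) (res h s) =
  res (preimS (cf := @id_cont X) h) (res (@id_preim X V) s).
Proof.
have h' : preim (@id_cont X) W `<=` V by move=> x /h.
by rewrite !(res_comp _ _ h').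
Qed.

Lemma id_sharp_local (X : lrs) (x : X) (V : opens X) (s : sec V) :
  opens_set V x -> unit_at x (res (@id_preim X V) s) -> unit_at x s.
Proof. by move=> _; exact: unit_at_res. Qed.

Definition id_mor (X : lrs) : mor X X :=
  @Mor X X id (@id_cont X) (fun V => res (@id_preim X V))
    (@id_sharp_res X) (@id_sharp_local X).

Variables (X Y Z : lrs) (g : mor Y Z) (f : mor X Y).

Lemma comp_cont : continuous (g \o f).
Proof.
by move=> x; apply: continuous_comp; [exact: mor_cont | exact: mor_cont].
Qed.

Lemma comp_preim (V : opens Z) :
  preim comp_cont V `<=` preim (@mor_cont _ _ f) (preim (@mor_cont _ _ g) V).
Proof. by []. Qed.

Definition comp_sharp (V : opens Z) : {rmorphism sec V -> sec (preim comp_cont V)} :=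
  res (@comp_preim V) \o (sharp f (preim (@mor_cont _ _ g) V) \o sharp g V).

Lemma comp_sharp_res (V W : opens Z) (h : W `<=` V) (s : sec V) :
  comp_sharp W (res h s) = res (preimS (cf := comp_cont) h) (comp_sharp V s).
Proof.
rewrite /comp_sharp /= !sharp_res.
have h' : preim comp_cont W `<=`
    preim (@mor_cont _ _ f) (preim (@mor_cont _ _ g) V) by move=> x /h.
by rewrite !(res_comp _ _ h').
Qed.

Lemma comp_sharp_local (x : X) (V : opens Z) (s : sec V) :
  opens_set V (g (f x)) -> unit_at x (comp_sharp V s) -> unit_at (g (f x)) s.
Proof.
move=> Vx /unit_at_res ux; apply: sharp_local => //.
exact: sharp_local ux.
Qed.

Definition comp_mor : mor X Z :=
  @Mor X Z (g \o f) comp_cont comp_sharp comp_sharp_res comp_sharp_local.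

End IdComp.

Notation "g \oM f" := (comp_mor g f) (at level 50).

Definition is_iso (X Y : lrs) (f : mor X Y) : Prop :=
  exists g : mor Y X, g \oM f = id_mor X /\ f \oM g = id_mor Y.

Record prime_ideal (A : comPzRingType) := PrimeIdeal {
  pi_set :> A -> Prop ;
  pi0 : pi_set 0 ;
  piD : forall a b, pi_set a -> pi_set b -> pi_set (a + b) ;
  piM : forall a b, pi_set b -> pi_set (a * b) ;
  pi1 : ~ pi_set 1 ;
  pi_prime : forall a b, pi_set (a * b) -> pi_set a \/ pi_set b }.

Lemma prime_ext (A : comPzRingType) (p q : prime_ideal A) :
  (forall a, p a <-> q a) -> p = q.
Proof.
case: p q => [p p0 pD pM p1 pP] [q q0 qD qM q1 qP] /= epq.
have {}epq : p = q by apply/funext => a; apply/propext.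
by subst q; congr PrimeIdeal; exact: Prop_irrelevance.
Qed.

HB.instance Definition _ (A : comPzRingType) := gen_eqMixin (prime_ideal A).
HB.instance Definition _ (A : comPzRingType) := gen_choiceMixin (prime_ideal A).

Section Zariski.
Variable A : comPzRingType.

(* the closed sets are the V(E) = {p | E is contained in p} *)
Definition zariski_open (U : set (prime_ideal A)) : Prop :=
  exists E : set A, U = [set p | exists2 a, E a & ~ p a].

Lemma zariski_openT : zariski_open setT.
Proof.
by exists [set 1]; apply/seteqP; split=> // p _; exists 1 => //; exact: pi1.
Qed.

Lemma zariski_openI : setI_closed zariski_open.
Proof.
move=> _ _ [E ->] [F ->]; exists [set a * b | a in E & b in F].
apply/seteqP; split=> p.
  move=> [[a Ea pa] [b Fb pb]]; exists (a * b); first by exists a => //; exists b.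
  by move=> /pi_prime[].
move=> [_ [a Ea [b Fb <-]] pab]; split.
  by exists a => // pa; apply: pab; rewrite mulrC; exact: piM.
by exists b => // pb; apply: pab; exact: piM.
Qed.

Lemma zariski_open_bigU (I : Type) (f : I -> set (prime_ideal A)) :
  (forall i, zariski_open (f i)) -> zariski_open (\bigcup_i f i).
Proof.
move=> /choice[E fE]; exists (\bigcup_i E i); apply/seteqP; split=> p.
  by move=> [i _]; rewrite fE => -[a Ea pa]; exists a => //; exists i.
by move=> [a [i _ Ea] pa]; exists i => //; rewrite fE; exists a.
Qed.

HB.instance Definition _ := isOpenTopological.Build (prime_ideal A)
  zariski_openT zariski_openI zariski_open_bigU.

Lemma zariski_openE (U : set (prime_ideal A)) : open U <-> zariski_open U.
Proof. by []. Qed.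

End Zariski.

Record denom (A : comPzRingType) (p : prime_ideal A) :=
  Denom { dval :> A ; denomP : ~ p dval }.

HB.instance Definition _ A (p : prime_ideal A) := gen_eqMixin (denom p).
HB.instance Definition _ A (p : prime_ideal A) := gen_choiceMixin (denom p).

Section Loc.
Variables (A : comPzRingType) (p : prime_ideal A).
Implicit Types (a b c : A) (s t r : denom p).

Definition denom1 : denom p := Denom (@pi1 A p).

Lemma denomM_proof s t : ~ p (dval s * dval t).
Proof. by move=> /pi_prime[]; exact: denomP. Qed.

Definition denomM s t : denom p := Denom (@denomM_proof s t).

Definition loc_eq (x y : A * denom p) : bool :=
  `[< exists u : denom p,
        dval u * (x.1 * dval y.2) = dval u * (y.1 * dval x.2) >].

Lemma loc_eq_refl : reflexive loc_eq.
Proof. by move=> x; apply/asboolP; exists denom1. Qed.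

Lemma loc_eq_sym : symmetric loc_eq.
Proof. by move=> x y; apply/asboolP/asboolP => -[u e]; exists u. Qed.

Lemma loc_eq_trans : transitive loc_eq.
Proof.
move=> [b t] [a s] [c r] /asboolP[u /= e] /asboolP[v /= e']; apply/asboolP.
exists (denomM (denomM u v) t) => /=.
transitivity (dval v * dval r * (dval u * (a * dval t))); first by ring.
rewrite e; transitivity (dval u * dval s * (dval v * (b * dval r))).
  by ring.
by rewrite e'; ring.
Qed.

Canonical loc_equiv := EquivRel loc_eq loc_eq_refl loc_eq_sym loc_eq_trans.

Definition loc := {eq_quot loc_equiv}.

HB.instance Definition _ : EqQuotient _ loc_equiv loc := EqQuotient.on loc.
HB.instance Definition _ := Choice.on loc.

Definition frac a s : loc := \pi_loc (a, s).

Lemma fracE a b s t : frac a s = frac b t <->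
  exists u : denom p, dval u * (a * dval t) = dval u * (b * dval s).
Proof.
split; first by move=> /eqmodP/asboolP.
by move=> e; apply/eqmodP/asboolP.
Qed.

Lemma frac_eq a b s t : a * dval t = b * dval s -> frac a s = frac b t.
Proof. by move=> e; apply/fracE; exists denom1; rewrite e. Qed.

Lemma fracP (x : loc) : exists a s, x = frac a s.
Proof.
by exists (repr x).1, (repr x).2; rewrite /frac -surjective_pairing reprK.
Qed.

Lemma frac_repr a s : exists u : denom p,
  dval u * ((repr (frac a s)).1 * dval s) =
  dval u * (a * dval (repr (frac a s)).2).
Proof. by apply/fracE; rewrite /frac -surjective_pairing reprK. Qed.

Definition loc_add (x y : loc) : loc :=
  frac ((repr x).1 * dval (repr y).2 + (repr y).1 * dval (repr x).2)
       (denomM (repr x).2 (repr y).2).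
Definition loc_mul (x y : loc) : loc :=
  frac ((repr x).1 * (repr y).1) (denomM (repr x).2 (repr y).2).
Definition loc_opp (x : loc) : loc := frac (- (repr x).1) (repr x).2.

Lemma loc_addE a b s t : loc_add (frac a s) (frac b t) =
  frac (a * dval t + b * dval s) (denomM s t).
Proof.
have [u] := frac_repr a s; have [v] := frac_repr b t; rewrite /loc_add.
move: (repr _) (repr _) => [a' s'] [b' t'] /= ev eu.
apply/fracE; exists (denomM u v) => /=.
transitivity (dval u * (a' * dval s) * (dval v * dval t' * dval t) +
  dval v * (b' * dval t) * (dval u * dval s' * dval s)); first by ring.
by rewrite eu ev; ring.
Qed.

Lemma loc_mulE a b s t :
  loc_mul (frac a s) (frac b t) = frac (a * b) (denomM s t).
Proof.
have [u] := frac_repr a s; have [v] := frac_repr b t; rewrite /loc_mul.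
move: (repr _) (repr _) => [a' s'] [b' t'] /= ev eu.
apply/fracE; exists (denomM u v) => /=.
transitivity (dval u * (a' * dval s) * (dval v * (b' * dval t))).
  by ring.
by rewrite eu ev; ring.
Qed.

Lemma loc_oppE a s : loc_opp (frac a s) = frac (- a) s.
Proof.
have [u eu] := frac_repr a s; apply/fracE; exists u.
by rewrite !mulNr !mulrN eu.
Qed.

Lemma loc_addA : associative loc_add.
Proof.
move=> x y z; have [a [s ->]] := fracP x; have [b [t ->]] := fracP y.
have [c [r ->]] := fracP z; rewrite !loc_addE; apply: frac_eq => /=; ring.
Qed.

Lemma loc_addC : commutative loc_add.
Proof.
move=> x y; have [a [s ->]] := fracP x; have [b [t ->]] := fracP y.
by rewrite !loc_addE; apply: frac_eq => /=; ring.
Qed.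

Lemma loc_add0 : left_id (frac 0 denom1) loc_add.
Proof.
move=> x; have [a [s ->]] := fracP x.
by rewrite !loc_addE; apply: frac_eq => /=; ring.
Qed.

Lemma loc_addN : left_inverse (frac 0 denom1) loc_opp loc_add.
Proof.
move=> x; have [a [s ->]] := fracP x.
by rewrite loc_oppE loc_addE; apply: frac_eq => /=; ring.
Qed.

HB.instance Definition _ :=
  GRing.isZmodule.Build loc loc_addA loc_addC loc_add0 loc_addN.

Lemma loc_mulA : associative loc_mul.
Proof.
move=> x y z; have [a [s ->]] := fracP x; have [b [t ->]] := fracP y.
have [c [r ->]] := fracP z; rewrite !loc_mulE; apply: frac_eq => /=; ring.
Qed.

Lemma loc_mulC : commutative loc_mul.
Proof.
move=> x y; have [a [s ->]] := fracP x; have [b [t ->]] := fracP y.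
by rewrite !loc_mulE; apply: frac_eq => /=; ring.
Qed.

Lemma loc_mul1 : left_id (frac 1 denom1) loc_mul.
Proof.
move=> x; have [a [s ->]] := fracP x.
by rewrite !loc_mulE; apply: frac_eq => /=; ring.
Qed.

Lemma loc_mulDl : left_distributive loc_mul loc_add.
Proof.
move=> x y z; have [a [s ->]] := fracP x; have [b [t ->]] := fracP y.
have [c [r ->]] := fracP z.
by rewrite !(loc_addE, loc_mulE); apply: frac_eq => /=; ring.
Qed.

HB.instance Definition _ :=
  GRing.Zmodule_isComPzRing.Build loc loc_mulA loc_mulC loc_mul1 loc_mulDl.

Lemma frac1E : (1 : loc) = frac 1 denom1. Proof. by []. Qed.
Lemma frac0E : (0 : loc) = frac 0 denom1. Proof. by []. Qed.
Lemma fracN a s : - frac a s = frac (- a) s. Proof. exact: loc_oppE. Qed.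
Lemma fracM a b s t : frac a s * frac b t = frac (a * b) (denomM s t).
Proof. exact: loc_mulE. Qed.
Lemma fracD a b s t :
  frac a s + frac b t = frac (a * dval t + b * dval s) (denomM s t).
Proof. exact: loc_addE. Qed.

End Loc.

Section SpecSheaf.
Variable A : comPzRingType.
Implicit Types U V W : opens (prime_ideal A).

(* the sections over U of the structure sheaf of Spec A are the families of
   elements of the A_p, p in U, that are locally given by one fraction a / b *)
Definition loc_const U (s : forall p, opens_set U p -> loc p) : Prop :=
  forall p, opens_set U p ->
  exists (W : opens (prime_ideal A)) (a b : A), opens_set W p /\
    forall q (Uq : opens_set U q), opens_set W q ->
      exists qb : ~ q b, s q Uq = frac a (Denom qb).

Record section_of U := MkSection {
  sval_at :> forall p, opens_set U p -> loc p ;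
  section_loc : loc_const sval_at }.

Lemma section_ext U (s t : section_of U) :
  (forall p Up, s p Up = t p Up) -> s = t.
Proof.
case: s t => [s ls] [t lt] /= est.
have {}est : s = t.
  by apply: functional_extensionality_dep => p; apply/funext => Up; exact: est.
by subst t; rewrite (Prop_irrelevance ls lt).
Qed.

HB.instance Definition _ U := gen_eqMixin (section_of U).
HB.instance Definition _ U := gen_choiceMixin (section_of U).

Definition opensI U V : opens (prime_ideal A) :=
  Opens (openI (opensP U) (opensP V)).

Lemma sec_const_proof U a : loc_const (fun p (_ : opens_set U p) => frac a (denom1 p)).
Proof.
move=> p Up; exists U, a, 1; split=> // q _ _; exists (@pi1 _ q).
exact: frac_eq.
Qed.

Definition sec_const U a : section_of U := MkSection (@sec_const_proof U a).

Lemma sec_opp_proof U (s : section_of U) :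
  loc_const (fun p (Up : opens_set U p) => - s p Up).
Proof.
move=> p Up; have [W [a [b [Wp sW]]]] := section_loc s Up.
exists W, (- a), b; split=> // q Uq Wq; have [qb ->] := sW q Uq Wq.
by exists qb; rewrite fracN.
Qed.

Lemma sec_add_proof U (s t : section_of U) :
  loc_const (fun p (Up : opens_set U p) => s p Up + t p Up).
Proof.
move=> p Up; have [W [a [b [Wp sW]]]] := section_loc s Up.
have [W' [a' [b' [Wp' sW']]]] := section_loc t Up.
exists (opensI W W'), (a * b' + a' * b), (b * b'); split=> // q Uq [Wq Wq'].
have [qb ->] := sW q Uq Wq; have [qb' ->] := sW' q Uq Wq'.
exists (@denomM_proof _ q (Denom qb) (Denom qb')).
by rewrite fracD; exact: frac_eq.
Qed.

Lemma sec_mul_proof U (s t : section_of U) :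
  loc_const (fun p (Up : opens_set U p) => s p Up * t p Up).
Proof.
move=> p Up; have [W [a [b [Wp sW]]]] := section_loc s Up.
have [W' [a' [b' [Wp' sW']]]] := section_loc t Up.
exists (opensI W W'), (a * a'), (b * b'); split=> // q Uq [Wq Wq'].
have [qb ->] := sW q Uq Wq; have [qb' ->] := sW' q Uq Wq'.
exists (@denomM_proof _ q (Denom qb) (Denom qb')).
by rewrite fracM; exact: frac_eq.
Qed.

Section Ring.
Variable U : opens (prime_ideal A).
Implicit Types s t r : section_of U.

Definition sec_opp s := MkSection (sec_opp_proof s).
Definition sec_add s t := MkSection (sec_add_proof s t).
Definition sec_mul s t := MkSection (sec_mul_proof s t).

Lemma sec_addA : associative sec_add.
Proof. by move=> *; apply: section_ext => p Up; exact: addrA. Qed.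
Lemma sec_addC : commutative sec_add.
Proof. by move=> *; apply: section_ext => p Up; exact: addrC. Qed.
Lemma sec_add0 : left_id (sec_const U 0) sec_add.
Proof. by move=> *; apply: section_ext => p Up; exact: add0r. Qed.
Lemma sec_addN : left_inverse (sec_const U 0) sec_opp sec_add.
Proof. by move=> *; apply: section_ext => p Up; exact: addNr. Qed.

HB.instance Definition _ :=
  GRing.isZmodule.Build (section_of U) sec_addA sec_addC sec_add0 sec_addN.

Lemma sec_mulA : associative sec_mul.
Proof. by move=> *; apply: section_ext => p Up; exact: mulrA. Qed.
Lemma sec_mulC : commutative sec_mul.
Proof. by move=> *; apply: section_ext => p Up; exact: mulrC. Qed.
Lemma sec_mul1 : left_id (sec_const U 1) sec_mul.
Proof. by move=> *; apply: section_ext => p Up; exact: mul1r. Qed.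
Lemma sec_mulDl : left_distributive sec_mul sec_add.
Proof. by move=> *; apply: section_ext => p Up; exact: mulrDl. Qed.

HB.instance Definition _ := GRing.Zmodule_isComPzRing.Build (section_of U)
  sec_mulA sec_mulC sec_mul1 sec_mulDl.

End Ring.

Section Restriction.
Variables (U V : opens (prime_ideal A)) (h : V `<=` U).

Lemma sec_res_proof (s : section_of U) :
  loc_const (fun p (Vp : opens_set V p) => s p (h Vp)).
Proof.
move=> p Vp; have [W [a [b [Wp sW]]]] := section_loc s (h Vp).
by exists W, a, b; split=> // q Vq Wq; exact: sW.
Qed.

Definition sec_res (s : section_of U) : section_of V :=
  MkSection (sec_res_proof s).

Lemma sec_res_zmod : zmod_morphism sec_res.
Proof. by move=> s t; exact: section_ext. Qed.

Lemma sec_res_monoid : monoid_morphism sec_res.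
Proof. by split=> [|s t]; exact: section_ext. Qed.

HB.instance Definition _ :=
  GRing.isZmodMorphism.Build (section_of U) (section_of V) sec_res sec_res_zmod.
HB.instance Definition _ :=
  GRing.isMonoidMorphism.Build (section_of U) (section_of V) sec_res
    sec_res_monoid.

End Restriction.

Lemma sec_res_id U (h : U `<=` U) (s : section_of U) : sec_res h s = s.
Proof.
by apply: section_ext => p Up /=; congr (s p _); exact: Prop_irrelevance.
Qed.

Lemma sec_res_comp U V W (h : V `<=` U) (h' : W `<=` V) (h'' : W `<=` U)
  (s : section_of U) : sec_res h' (sec_res h s) = sec_res h'' s.
Proof.
by apply: section_ext => p Up /=; congr (s p _); exact: Prop_irrelevance.
Qed.

Lemma sec_glue U (I : Type) (V : I -> opens (prime_ideal A))
    (hV : forall i, V i `<=` U) (s : forall i, section_of (V i)) :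
  U `<=` \bigcup_i V i ->
  (forall i j W (hi : W `<=` V i) (hj : W `<=` V j),
     sec_res hi (s i) = sec_res hj (s j)) ->
  exists! t : section_of U, forall i, sec_res (hV i) t = s i.
Proof.
move=> cov comp.
have comp' i j p (Vi : opens_set (V i) p) (Vj : opens_set (V j) p) :
    s i p Vi = s j p Vj.
  have hi : opensI (V i) (V j) `<=` V i by move=> q [].
  have hj : opensI (V i) (V j) `<=` V j by move=> q [].
  have Vp : opens_set (opensI (V i) (V j)) p by [].
  have := congr1 (fun x : section_of _ => x p Vp) (comp i j _ hi hj).
  by rewrite /= (Prop_irrelevance (hi p Vp) Vi) (Prop_irrelevance (hj p Vp) Vj).
have pick p : opens_set U p -> {i | opens_set (V i) p}.
  by move=> Up; apply: cid; have [i _ Vi] := cov p Up; exists i.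
pose t p (Up : opens_set U p) := s (sval (pick p Up)) p (svalP (pick p Up)).
have lt : loc_const t.
  move=> p Up; have Vp := svalP (pick p Up); set i := sval _ in Vp.
  have [W [a [b [Wp sW]]]] := section_loc (s i) Vp.
  exists (opensI W (V i)), a, b; split=> // q Uq [Wq Vq].
  have [qb e] := sW q Vq Wq; exists qb; rewrite -e; exact: comp'.
exists (MkSection lt); split=> [i|t' et'].
  by apply: section_ext => p Vp; exact: comp'.
apply: section_ext => p Up /=; rewrite /t.
rewrite -(et' (sval (pick p Up))) /=; congr (t' p _); exact: Prop_irrelevance.
Qed.

Definition Spec_rs : ringed_space :=
  @RingedSpace (prime_ideal A) section_of (fun U V h => @sec_res U V h)
    sec_res_id sec_res_comp sec_glue.

Lemma Spec_nontrivial (p : Spec_rs) (U : opens Spec_rs) : opens_set U p ->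
  (1 : sec U) <> 0.
Proof.
move=> Up /(congr1 (fun s : section_of U => s p Up)) /= /fracE[u /= eu].
apply: (@denomP _ _ u); rewrite -[dval u]mulr1 -[X in dval u * X]mulr1.
by rewrite eu mul0r mulr0; exact: pi0.
Qed.

Definition basic_open (f : A) : set (prime_ideal A) := [set p | ~ p f].

Lemma basic_openP (f : A) : open (basic_open f).
Proof.
apply/zariski_openE; exists [set f]; apply/seteqP; split=> p.
  by move=> pf; exists f.
by move=> [_ ->].
Qed.

Lemma Spec_unit_at (p : Spec_rs) (U : opens Spec_rs) (s : sec U)
    (Up : opens_set U p) :
  unit_at p s <-> is_unit ((s : section_of U) p Up).
Proof.
split.
  move=> [V [h [Vp [t /(congr1 (fun x : section_of V => x p Vp)) /= e]]]].
  exists ((t : section_of V) p Vp); rewrite -[RHS]e; congr (s p _ * _).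
  exact: Prop_irrelevance.
have [W [a [b [Wp sW]]]] := section_loc s Up.
have [pb ->] := sW p Up Wp => -[x]; have [c [r ->]] := fracP x.
rewrite fracM => /fracE[u /= e].
have pa : ~ p a.
  move=> pa; have : p (dval u * (1 * (b * dval r))).
    by rewrite -e; apply: piM; rewrite mulr1 mulrC; apply: piM.
  move=> /pi_prime[]; first exact: denomP.
  by rewrite mul1r => /pi_prime[]; [exact: pb | exact: denomP].
pose V := opensI (opensI W U) (Opens (basic_openP a)).
have h : V `<=` U by move=> q [[]].
exists V, h; split => //.
have qb q (Vq : opens_set V q) : ~ q b.
  by have [[Wq Uq] _] := Vq; have [] := sW q Uq Wq.
have qa q (Vq : opens_set V q) : ~ q a by have [] := Vq.
have lt : @loc_const V (fun q Vq => frac b (Denom (@qa q Vq))).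
  move=> q Vq; exists V, b, a; split=> // q' Vq' _; exists (@qa q' Vq').
  exact: frac_eq.
exists (MkSection lt); apply: section_ext => q Vq /=.
have [[Wq Uq] _] := Vq; have [qb' e'] := sW q Uq Wq.
transitivity ((s : section_of U) q (h q Vq) * frac b (Denom (@qa q Vq))).
  by [].
rewrite (Prop_irrelevance (h q Vq) Uq) e' fracM; apply: frac_eq => /=.
by ring.
Qed.

Lemma loc_unit (p : prime_ideal A) a (s : denom p) :
  is_unit (frac a s) <-> ~ p a.
Proof.
split=> [[x]|pa]; last first.
  by exists (frac (dval s) (Denom pa)); rewrite fracM; apply: frac_eq => /=; ring.
have [c [r ->]] := fracP x; rewrite fracM => /fracE[u /= e] pa.
have : p (dval u * (1 * (dval s * dval r))).
  by rewrite -e; apply: piM; rewrite mulr1 mulrC; apply: piM.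
move=> /pi_prime[]; first exact: denomP.
by rewrite mul1r => /pi_prime[]; exact: denomP.
Qed.

Lemma Spec_stalk_local (p : Spec_rs) (U : opens Spec_rs) (s t : sec U) :
  opens_set U p -> unit_at p (s + t) -> unit_at p s \/ unit_at p t.
Proof.
move=> Up; rewrite !(Spec_unit_at _ Up).
rewrite [X in is_unit X](_ : _ = (s : section_of U) p Up + (t : section_of U) p Up) //.
have [a [r ->]] := fracP (sval_at s Up); have [b [r' ->]] := fracP (sval_at t Up).
rewrite fracD !loc_unit => pab.
have [pa|pa] := pselect (p a); last by left.
right=> pb; apply: pab; apply: piD; rewrite mulrC; exact: piM.
Qed.

Definition Spec : lrs := @Lrs Spec_rs Spec_nontrivial Spec_stalk_local.

End SpecSheaf.

Section SpecMap.
Variables (A B : comPzRingType) (f : {rmorphism A -> B}).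

Section Comap.
Variable q : prime_ideal B.

Lemma comap0 : q (f 0). Proof. by rewrite rmorph0; exact: pi0. Qed.
Lemma comapD a b : q (f a) -> q (f b) -> q (f (a + b)).
Proof. by rewrite rmorphD; exact: piD. Qed.
Lemma comapM a b : q (f b) -> q (f (a * b)).
Proof. by rewrite rmorphM; exact: piM. Qed.
Lemma comap1 : ~ q (f 1). Proof. by rewrite rmorph1; exact: pi1. Qed.
Lemma comap_prime a b : q (f (a * b)) -> q (f a) \/ q (f b).
Proof. by rewrite rmorphM; exact: pi_prime. Qed.

Definition comap : prime_ideal A :=
  @PrimeIdeal A (fun a => q (f a)) comap0 comapD comapM comap1 comap_prime.

Definition comap_denom (s : denom comap) : denom q :=
  @Denom B q (f (dval s)) (@denomP _ _ s).

Definition loc_map (x : loc comap) : loc q :=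
  frac (f (repr x).1) (comap_denom (repr x).2).

Lemma loc_mapE a s : loc_map (frac a s) = frac (f a) (comap_denom s).
Proof.
have [u] := frac_repr a s; rewrite /loc_map.
move: (repr _) => [a' s'] /= /(congr1 f) e; apply/fracE.
by exists (comap_denom u) => /=; move: e; rewrite !rmorphM.
Qed.

Lemma loc_mapD : {morph loc_map : x y / x + y}.
Proof.
move=> x y; have [a [s ->]] := fracP x; have [b [t ->]] := fracP y.
rewrite fracD !loc_mapE fracD; apply: frac_eq => /=.
by rewrite !(rmorphM, rmorphD).
Qed.

Lemma loc_mapM : {morph loc_map : x y / x * y}.
Proof.
move=> x y; have [a [s ->]] := fracP x; have [b [t ->]] := fracP y.
by rewrite fracM !loc_mapE fracM; apply: frac_eq; rewrite /= !rmorphM.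
Qed.

Lemma loc_mapN : {morph loc_map : x / - x}.
Proof.
move=> x; have [a [s ->]] := fracP x.
by rewrite fracN !loc_mapE fracN; apply: frac_eq; rewrite /= rmorphN.
Qed.

Lemma loc_map1 : loc_map 1 = 1.
Proof.
by rewrite !frac1E loc_mapE; apply: frac_eq; rewrite /= rmorph1.
Qed.

End Comap.

Lemma comap_cont : continuous comap.
Proof.
apply/continuousP => _ [E ->]; exists (f @` E); apply/seteqP; split=> q.
  by move=> [a Ea qa]; exists (f a) => //; exists a.
by move=> [_ [a Ea <-] qa]; exists a.
Qed.

Section Sharp.
Variable V : opens (prime_ideal A).

Lemma Spec_sharp_proof (s : section_of V) : @loc_const B (preim comap_cont V)
  (fun q Vq => loc_map (s (comap q) Vq)).
Proof.
move=> q Vq; have [W [a [b [Wq sW]]]] := section_loc s Vq.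
exists (preim comap_cont W), (f a), (f b); split=> // q' Vq' Wq'.
have [qb ->] := sW (comap q') Vq' Wq'.
by exists qb; rewrite loc_mapE; exact: frac_eq.
Qed.

Definition Spec_sharp (s : section_of V) : section_of (preim comap_cont V) :=
  MkSection (Spec_sharp_proof s).

Lemma Spec_sharp_zmod : zmod_morphism Spec_sharp.
Proof.
by move=> s t; apply: section_ext => q Vq /=; rewrite loc_mapD loc_mapN.
Qed.

Lemma Spec_sharp_monoid : monoid_morphism Spec_sharp.
Proof.
split=> [|s t]; apply: section_ext => q Vq /=; first exact: loc_map1.
exact: loc_mapM.
Qed.

HB.instance Definition _ := GRing.isZmodMorphism.Build (section_of V)
  (section_of (preim comap_cont V)) Spec_sharp Spec_sharp_zmod.
HB.instance Definition _ := GRing.isMonoidMorphism.Build (section_of V)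
  (section_of (preim comap_cont V)) Spec_sharp Spec_sharp_monoid.

End Sharp.

Lemma Spec_sharp_res (V W : opens (Spec A)) (h : W `<=` V) (s : sec V) :
  Spec_sharp (res h s) =
  res (r := Spec B) (preimS (cf := comap_cont) h) (Spec_sharp s).
Proof.
apply: section_ext => q Wq /=; congr (loc_map (s _ _)).
exact: Prop_irrelevance.
Qed.

Lemma Spec_sharp_local (q : Spec B) (V : opens (Spec A)) (s : sec V) :
  opens_set V (comap q) ->
  @unit_at (Spec B) q (preim comap_cont V) (Spec_sharp s) ->
  unit_at (comap q : Spec A) s.
Proof.
move=> Vq uq; apply: (@Spec_unit_at A (comap q) V s Vq).2.
have /= := (@Spec_unit_at B q (preim comap_cont V) (Spec_sharp s) Vq).1 uq.
have [a [r ->]] := fracP (sval_at s Vq).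
by rewrite loc_mapE !loc_unit.
Qed.

Definition Spec_map : mor (Spec B) (Spec A) :=
  @Mor (Spec B) (Spec A) comap comap_cont Spec_sharp
    Spec_sharp_res Spec_sharp_local.

End SpecMap.

Lemma Spec_map_section (A B : comPzRingType) (f : {rmorphism A -> B})
  (g : {rmorphism B -> A}) : cancel f g ->
  Spec_map f \oM Spec_map g = id_mor (Spec A).
Proof.
move=> fK; have eq1 (p : prime_ideal A) : comap f (comap g p) = p.
  by apply: prime_ext => a /=; rewrite fK.
apply: mor_ext => [p|V s U hf hg]; first exact: eq1.
apply: section_ext => p Up /=.
have Vp : opens_set V p := hg p Up.
have Vp' : opens_set V (comap f (comap g p)) := hf p Up.
have [W [a [b [Wp sW]]]] := section_loc (s : section_of V) Vp.
have Wp' : opens_set W (comap f (comap g p)) by rewrite eq1.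
have [pb e] := sW _ Vp Wp; have [pb' e'] := sW _ Vp' Wp'.
transitivity (sval_at (s : section_of V) Vp); last first.
  by congr (sval_at s _); exact: Prop_irrelevance.
transitivity (loc_map (loc_map (sval_at (s : section_of V) Vp'))).
  by congr (loc_map (loc_map (sval_at s _))); exact: Prop_irrelevance.
by rewrite e e' !loc_mapE; apply: frac_eq; rewrite /= !fK.
Qed.

(* f is a homeomorphism onto an open subset and f^-1 O_Y -> O_X is an
   isomorphism; as f is open, (f^-1 O_Y)(f^-1 V) = O_Y(V) for V open in the
   image of f. *)
Definition open_immersion (X Y : lrs) (f : mor X Y) : Prop :=
  [/\ injective f, forall U : set X, open U -> open (f @` U) &
      forall V : opens Y, V `<=` range f -> bijective (sharp f V)].

(* f is a homeomorphism onto a closed subset and O_Y -> f_* O_X is a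
   surjective morphism of sheaves. *)
Definition closed_immersion (X Y : lrs) (f : mor X Y) : Prop :=
  [/\ injective f, forall C : set X, closed C -> closed (f @` C) &
      forall (V : opens Y) (s : sec (preim (@mor_cont _ _ f) V)) (y : Y),
        opens_set V y ->
        exists (W : opens Y) (h : W `<=` V) (t : sec W), opens_set W y /\
          sharp f W t = res (preimS (cf := @mor_cont _ _ f) h) s].

Definition is_affine (X : lrs) : Prop :=
  exists (A : comPzRingType) (f : mor X (Spec A)), is_iso f.

Definition is_scheme (X : lrs) : Prop :=
  forall x : X, exists (A : comPzRingType) (j : mor (Spec A) X),
    open_immersion j /\ range j x.

Lemma comp_idl (X Y : lrs) (f : mor X Y) : id_mor Y \oM f = f.
Proof.
apply: mor_ext => // V s U hf hg /=; rewrite sharp_res.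
by rewrite !res_trans; exact: res_irr.
Qed.

Lemma comp_idr (X Y : lrs) (f : mor X Y) : f \oM id_mor X = f.
Proof.
apply: mor_ext => // V s U hf hg /=.
by rewrite !res_trans; exact: res_irr.
Qed.

Lemma comp_morA (X Y Z T : lrs) (h : mor Z T) (g : mor Y Z) (f : mor X Y) :
  h \oM (g \oM f) = (h \oM g) \oM f.
Proof.
apply: mor_ext => // V s U hf hg /=; rewrite sharp_res.
by rewrite !res_trans; exact: res_irr.
Qed.

Lemma id_open_immersion (X : lrs) : open_immersion (id_mor X).
Proof.
split=> [//|U|V _]; first by rewrite image_id.
exists (res (r := X) (U := preim (@id_cont X) V) (V := V) (fun _ => id)) => s.
  by rewrite /= (res_comp _ _ (@subset_refl _ V)) res_id.
by rewrite /= (res_comp _ _ (@subset_refl _ (preim (@id_cont X) V))) res_id.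
Qed.

Lemma Spec_is_scheme (A : comPzRingType) : is_scheme (Spec A).
Proof.
move=> p; exists A, (id_mor _); split; first exact: id_open_immersion.
by exists p.
Qed.

Section KSchemes.
Variable k : comPzRingType.

Record kscheme := KScheme {
  ks_lrs :> lrs ;
  ks_scheme : is_scheme ks_lrs ;
  ks_str : mor ks_lrs (Spec k) }.

Record kmor (X Y : kscheme) := KMor {
  kmor_mor :> mor X Y ;
  kmor_over : ks_str Y \oM kmor_mor = ks_str X }.

Lemma kmor_ext (X Y : kscheme) (f g : kmor X Y) :
  (f : mor X Y) = g -> f = g.
Proof.
case: f g => [f pf] [g pg] /= efg; subst g.
by rewrite (Prop_irrelevance pf pg).
Qed.

Lemma kcomp_over (X Y Z : kscheme) (g : kmor Y Z) (f : kmor X Y) :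
  ks_str Z \oM (g \oM f) = ks_str X.
Proof. by rewrite comp_morA !kmor_over. Qed.

Definition kcomp (X Y Z : kscheme) (g : kmor Y Z) (f : kmor X Y) : kmor X Z :=
  KMor (kcomp_over g f).

Definition kbase : kscheme := KScheme (@Spec_is_scheme k) (id_mor (Spec k)).

(* A k-algebra A is given by its structure morphism phi : k -> A, as the
   algebra structures of the library exclude the zero ring. *)
Definition kSpec (A : comPzRingType) (phi : {rmorphism k -> A}) : kscheme :=
  KScheme (@Spec_is_scheme A) (Spec_map phi).

Definition rpoints (X : kscheme) := kmor kbase X.

Definition push (X Y : kscheme) (f : kmor X Y) (x : rpoints X) : rpoints Y :=
  kcomp f x.

Record khom (A : comPzRingType) (phi : {rmorphism k -> A}) := KHom {
  khom_mor :> {rmorphism A -> k} ;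
  khomK : cancel phi khom_mor }.

(* the identification of Hom_k(A, k) with (Spec A)(k) *)
Definition kpoint (A : comPzRingType) (phi : {rmorphism k -> A})
  (f : khom phi) : rpoints (kSpec phi) :=
  @KMor kbase (kSpec phi) (Spec_map f) (Spec_map_section (@khomK _ _ f)).

Definition jointly_surjective (I : Type) (X : kscheme) (U : I -> kscheme)
  (j : forall i, kmor (U i) X) : Prop := forall x : X, exists i, range (j i) x.

Definition affine_open_cover (I : Type) (X : kscheme) (U : I -> kscheme)
    (j : forall i, kmor (U i) X) : Prop :=
  [/\ forall i, is_affine (U i), forall i, open_immersion (j i) &
      jointly_surjective j].

(* P, with its projections p and q, is the fibre product of f and g *)
Definition is_pullback (X Y Z P : kscheme) (f : kmor X Z) (g : kmor Y Z)
    (p : kmor P X) (q : kmor P Y) : Prop :=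
  kcomp f p = kcomp g q /\
  forall (T : kscheme) (a : kmor T X) (b : kmor T Y), kcomp f a = kcomp g b ->
    exists! c : kmor T P, kcomp p c = a /\ kcomp q c = b.

End KSchemes.

Section FiniteType.
Variable k : comNzRingType.

Definition affine_space (n : nat) : kscheme k :=
  kSpec (@mpoly.mpolyC n k : {rmorphism k -> mpoly.mpoly n k}).

Definition affine_line : kscheme k :=
  kSpec (@polyC k : {rmorphism k -> {poly k}}).

Definition fg_algebra (A : comPzRingType) (phi : {rmorphism k -> A}) : Prop :=
  exists (n : nat) (pi : {rmorphism mpoly.mpoly n k -> A}),
    (forall c, pi (@mpoly.mpolyC n k c) = phi c) /\ set_surj setT setT pi.

Definition finite_type (X : kscheme k) : Prop :=
  exists (n : nat) (A : 'I_n -> comPzRingType)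
    (phi : forall i, {rmorphism k -> A i})
    (j : forall i, kmor (kSpec (phi i)) X),
    [/\ forall i, fg_algebra (phi i), forall i, open_immersion (j i) &
        jointly_surjective j].

Lemma eval_lineK (c : k) : cancel (@polyC k) (horner_eval c).
Proof. by move=> a; rewrite /horner_eval hornerC. Qed.

Definition eval_line (c : k) : khom (@polyC k : {rmorphism k -> {poly k}}) :=
  @KHom k _ _ (horner_eval c : {rmorphism {poly k} -> k}) (eval_lineK c).

Lemma eval_spaceK (n : nat) (c : 'I_n -> k) :
  cancel (@mpoly.mpolyC n k) (mpoly.meval c).
Proof. by move=> a; rewrite mpoly.mevalC. Qed.

Definition eval_space (n : nat) (c : 'I_n -> k) :
    khom (@mpoly.mpolyC n k : {rmorphism k -> mpoly.mpoly n k}) :=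
  @KHom k _ _ (mpoly.meval c : {rmorphism mpoly.mpoly n k -> k})
    (eval_spaceK c).

(* inverses of the canonical bijections A^1(k) -> k and A^n(k) -> k^n *)
Definition line_point (c : k) : rpoints affine_line := kpoint (eval_line c).
Definition space_point (n : nat) (c : 'I_n -> k) : rpoints (affine_space n) :=
  kpoint (eval_space c).

End FiniteType.

HB.mixin Record isMulContinuous R & Topological R & GRing.ComUnitRing R := {
  mul_continuous : continuous (fun x : R * R => x.1 * x.2) }.

(* topological commutative rings (inversion on the units is not required to
   be continuous) *)
#[short(type="topComUnitRingType")]
HB.structure Definition TopComUnitRing :=
  {R of TopologicalZmodule R & GRing.ComUnitRing R & isMulContinuous R}.

(* As multiplication is continuous on k, the units form a topological group in
   the subspace topology iff inversion is continuous on them. *)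
Definition local_hausdorff_open_units (k : topComUnitRingType) : Prop :=
  [/\ local_ring k, hausdorff_space k,
      open [set a : k | a \is a GRing.unit] &
      {within [set a : k | a \is a GRing.unit], continuous (@GRing.inv k)}].

Definition homeomorphism (S T : topologicalType) (f : S -> T) : Prop :=
  [/\ bijective f, continuous f & forall U : set S, open U -> open (f @` U)].

Definition embedding (S T : topologicalType) (f : S -> T) : Prop :=
  injective f /\
  forall U : set S, open U <-> exists2 V : set T, open V & U = f @^-1` V.

Definition open_embedding (S T : topologicalType) (f : S -> T) : Prop :=
  embedding f /\ open (range f).

Definition closed_embedding (S T : topologicalType) (f : S -> T) : Prop :=
  embedding f /\ closed (range f).

Section AffineTopology.
Variables (k : topComUnitRingType) (A : comPzRingType).
Variable phi : {rmorphism k -> A}.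

HB.instance Definition _ := gen_eqMixin (khom phi).
HB.instance Definition _ := gen_choiceMixin (khom phi).

Definition evaluation (a : A) (f : khom phi) : k := f a.

(* the coarsest topology making the evaluations at all a : A continuous *)
HB.instance Definition _ := Topological.copy (khom phi)
  (sup_topology (fun a => Topological.class (initial_topology (evaluation a)))).

End AffineTopology.

Section FineTopology.
Variables (k : topComUnitRingType) (X : kscheme k).

HB.instance Definition _ := gen_eqMixin (rpoints X).
HB.instance Definition _ := gen_choiceMixin (rpoints X).

(* the map U(k) -> X(k) induced by alpha : U -> X, for U = Spec A and
   U(k) = Hom_k(A, k) *)
Definition affine_push (A : comPzRingType) (phi : {rmorphism k -> A})
  (alpha : kmor (kSpec phi) X) (f : khom phi) : rpoints X :=
  push alpha (kpoint f).

(* the final topology for all the maps U(k) -> X(k) *)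
Definition fine_open (W : set (rpoints X)) : Prop :=
  forall (A : comPzRingType) (phi : {rmorphism k -> A})
    (alpha : kmor (kSpec phi) X), open (affine_push alpha @^-1` W).

Lemma fine_openT : fine_open setT.
Proof. by move=> A phi alpha; rewrite preimage_setT; exact: openT. Qed.

Lemma fine_openI : setI_closed fine_open.
Proof.
move=> U V oU oV A phi alpha; rewrite preimage_setI; apply: openI.
  exact: oU.
exact: oV.
Qed.

Lemma fine_open_bigU (I : Type) (F : I -> set (rpoints X)) :
  (forall i, fine_open (F i)) -> fine_open (\bigcup_i F i).
Proof.
move=> oF A phi alpha; rewrite preimage_bigcup; apply: bigcup_open => i _.
exact: oF.
Qed.

HB.instance Definition _ := isOpenTopological.Build (rpoints X)
  fine_openT fine_openI fine_open_bigU.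

End FineTopology.

(* the choices made in the definition of the strong topology *)
Record strong_atlas (k : topComUnitRingType) (X : kscheme k) := StrongAtlas {
  sa_idx : Type ;
  sa_chart : sa_idx -> kscheme k ;
  sa_incl : forall i, kmor (sa_chart i) X ;
  sa_dim : sa_idx -> nat ;
  sa_emb : forall i, kmor (sa_chart i) (affine_space k (sa_dim i)) ;
  sa_cover : affine_open_cover sa_incl ;
  sa_closed : forall i, closed_immersion (sa_emb i) }.

(* the open sets of U(k) for the topology induced by the product topology of
   k^n along U(k) -> A^n(k) = k^n *)
Definition subspace_open (k : topComUnitRingType) (U : kscheme k) (n : nat)
    (e : kmor U (affine_space k n)) (W : set (rpoints U)) : Prop :=
  exists2 O : set {ptws 'I_n -> k}, open O &
    W = push e @^-1` (@space_point k n @` O).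

Definition strong_open (k : topComUnitRingType) (X : kscheme k)
    (a : strong_atlas X) (W : set (rpoints X)) : Prop :=
  forall i : sa_idx a, subspace_open (sa_emb i) (push (sa_incl i) @^-1` W).

Section FibreProduct.
Variables (k : topComUnitRingType) (X Y Z P : kscheme k).
Variables (f : kmor X Z) (g : kmor Y Z) (p : kmor P X) (q : kmor P Y).

Definition fibre_points : set (rpoints X * rpoints Y) :=
  [set xy | push f xy.1 = push g xy.2].

Lemma fibre_map_proof : is_pullback f g p q -> forall x : rpoints P,
  (push p x, push q x) \in fibre_points.
Proof.
move=> [epq _] x; apply/mem_set; apply: kmor_ext => /=.
by rewrite !comp_morA; congr (comp_mor _ x); exact: (congr1 (@kmor_mor _ _ _) epq).
Qed.

Definition fibre_map (h : is_pullback f g p q) (x : rpoints P) :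
  set_type fibre_points := exist _ (push p x, push q x) (fibre_map_proof h x).

End FibreProduct.

(* Main.v *)
(* Write m for the closed point of Spec k.  A k-point x of X factors through an
   open subscheme as soon as the latter contains x(m), and a section s of O_X
   on a neighbourhood of x(m) has a value s(x) in k.  Since locally s is a
   fraction b / a and inversion is continuous on the open set of units, the
   function s is continuous for the fine topology.

   The open immersions (F4) and the fibre products (F1) use the following
   device in place of localisations and tensor products.  If E is a space of
   k-points, let D be the ring of continuous functions E -> k.  Then
   E -> Hom_k(D, k) is continuous, a function without non-unit values is a unit
   of D, and a morphism out of Spec D can be compared pointwise on E.  A
   fine-open set pulled back along Spec D -> X -- where the morphism comes from
   factoring through an open immersion, or from the universal property of a
   fibre product -- gives an open subset of E.

   For a closed immersion Y -> X the functions on Y lift locally to X, so that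
   the topologies agree; a k-point of X at a point of Y either lifts to Y or is
   separated from Y(k) by a function of the ideal of Y, as k is Hausdorff. *)
Require Import Defs.
From HB Require Import structures.
From mathcomp Require Import all_boot all_order all_algebra.
From mathcomp Require Import all_classical topology.
From mathcomp Require Import ring tvs.
From mathcomp Require Import (canonicals, coercions) mpoly.

Set Implicit Arguments.
Unset Strict Implicit.
Unset Printing Implicit Defensive.

Import GRing.Theory.
Local Open Scope ring_scope.
Local Open Scope classical_set_scope.

Local Notation frac := Defs.frac.

Local Notation pre f V := (Defs.preim (@mor_cont _ _ f) V).

(** * Units and sections of ringed spaces *)

Section Units.
Variables (A B : comPzRingType).

Lemma is_unit1 : is_unit (1 : A).
Proof. by exists 1; rewrite mulr1. Qed.

Lemma is_unitM (a b : A) : is_unit (a * b) <-> is_unit a /\ is_unit b.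
Proof.
split=> [[c e]|[[a' ea] [b' eb]]]; last first.
  by exists (a' * b'); rewrite mulrACA ea eb mulr1.
by split; [exists (b * c)|exists (a * c)]; rewrite mulrA // (mulrC b).
Qed.

Lemma is_unit_rmorph (f : {rmorphism A -> B}) (a : A) :
  is_unit a -> is_unit (f a).
Proof. by move=> [b e]; exists (f b); rewrite -rmorphM e rmorph1. Qed.

Lemma is_unit_mulIr (a b u : A) : is_unit u -> a * u = b * u -> a = b.
Proof.
by move=> [v e] /(congr1 (fun x => x * v)); rewrite -!mulrA e !mulr1.
Qed.

End Units.

Lemma is_unitE (R : comUnitRingType) (a : R) : is_unit a <-> a \is a GRing.unit.
Proof.
split=> [[b ab1]|ua]; last by exists a^-1; rewrite mulrV.
by apply/unitrP; exists b; split=> //; rewrite mulrC.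
Qed.

Section RingedSpaces.
Variable X : ringed_space.
Implicit Types U V W : opens X.

Definition meet U V : opens X := Opens (openI (opensP U) (opensP V)).
Definition top : opens X := Opens (@openT X).

Lemma meetSl U V : meet U V `<=` U. Proof. by move=> x []. Qed.
Lemma meetSr U V : meet U V `<=` V. Proof. by move=> x []. Qed.
Lemma subT U : U `<=` top. Proof. by []. Qed.

(** Uniqueness in [res_glue]: both [s] and [t] glue the restrictions of [s] to the chosen
    neighbourhoods. *)
Lemma sec_ext_local U (s t : sec U) :
  (forall x, opens_set U x -> exists V (h : V `<=` U), opens_set V x /\
     res h s = res h t) -> s = t.
Proof.
move=> H.
have {}H (i : {x | opens_set U x}) : exists V : {V : opens X | V `<=` U},
    opens_set (sval V) (sval i) /\ res (svalP V) s = res (svalP V) t.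
  have [V [h [Vx e]]] := H _ (svalP i); exists (exist _ V h); split=> //.
  by rewrite (res_irr _ h) [RHS](res_irr _ h).
have {H}[V H] := choice H.
have cov : U `<=` \bigcup_i sval (V i).
  by move=> x Ux; exists (exist _ x Ux) => //; exact: (H _).1.
have agree i j (W : opens X) (hi : W `<=` sval (V i)) (hj : W `<=` sval (V j)) :
    res hi (res (svalP (V i)) s) = res hj (res (svalP (V j)) s).
  by rewrite !res_trans; exact: res_irr.
have [r [_ ur]] := res_glue (fun i => svalP (V i)) cov agree.
have <- := ur s (fun=> erefl); apply: ur => i; exact: esym (H i).2.
Qed.

Lemma unit_at_resE (x : X) U V (h : V `<=` U) (s : sec U) : opens_set V x ->
  unit_at x (res h s) <-> unit_at x s.
Proof.
move=> Vx; split; first exact: unit_at_res.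
move=> [W [hW [Wx uW]]].
exists (meet V W), (@meetSl V W); split=> //; rewrite res_trans.
rewrite (res_irr _ (subset_trans (@meetSr V W) hW)) -res_trans.
exact: is_unit_rmorph.
Qed.

Lemma is_unit_unit_at (x : X) U (s : sec U) : opens_set U x ->
  is_unit s -> unit_at x s.
Proof. by move=> Ux us; exists U, (fun=> id); split; rewrite ?res_id. Qed.

End RingedSpaces.

Lemma sharp_unit_at (X Y : lrs) (f : mor X Y) (x : X) (V : opens Y)
    (s : sec V) :
  unit_at (f x) s -> unit_at x (sharp f V s).
Proof.
move=> [W [h [Wx uW]]].
exists (pre f W), (@Defs.preimS X Y f (@mor_cont X Y f) V W h).
by split=> //; rewrite -sharp_res; exact: is_unit_rmorph.
Qed.

Lemma sharp_unit_atE (X Y : lrs) (f : mor X Y) (x : X) (V : opens Y)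
    (s : sec V) :
  opens_set V (f x) -> unit_at x (sharp f V s) <-> unit_at (f x) s.
Proof. by move=> Vx; split; [exact: sharp_local | exact: sharp_unit_at]. Qed.

(** The type of [sharp u V] depends on [u], so an equality of morphisms is applied to sections after
    restricting both sides to a common open set. *)
Lemma sharp_congr (T X : lrs) (u v : mor T X) (V : opens X) (s : sec V)
    (U : opens T) (hu : U `<=` pre u V) (hv : U `<=` pre v V) :
  u = v -> res hu (sharp u V s) = res hv (sharp v V s).
Proof. by move=> e; subst v; exact: res_irr. Qed.

(** * Open immersions *)

Section OpenImmersion.
Variables (X Y : lrs) (j : mor Y X) (oj : open_immersion j).

Lemma open_imm_inj : injective j. Proof. by case: oj. Qed.

Definition img (V : opens Y) : opens X :=
  Opens (let: And3 _ oj' _ := oj in oj' V (opensP V)).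

Lemma img_range V : img V `<=` range j.
Proof. by move=> _ [y _ <-]; exists y. Qed.

Lemma img_in V y : opens_set (img V) (j y) <-> opens_set V y.
Proof.
by split=> [[y' Vy' /open_imm_inj <-]//|Vy]; exists y.
Qed.

Lemma imgS (V W : opens Y) : W `<=` V -> img W `<=` img V.
Proof. by move=> h _ [y Wy <-]; exists y => //; exact: h. Qed.

Lemma img_pre (V : opens X) : img (pre j V) `<=` V.
Proof. by move=> _ [y Vy <-]. Qed.

Lemma pre_img (V : opens Y) : pre j (img V) `<=` V.
Proof. by move=> y /img_in. Qed.

Section Inverse.
Variables (V : opens X) (hV : V `<=` range j).

Let inverse_sig : {g : sec (pre j V) -> sec V |
  cancel (sharp j V) g /\ cancel g (sharp j V)}.
Proof. by apply: cid; case: oj => _ _ /(_ V hV)[g gK Kg]; exists g. Qed.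

Definition sharp_inv : sec (pre j V) -> sec V := sval inverse_sig.

Lemma sharpK : cancel (sharp j V) sharp_inv.
Proof. exact: (svalP inverse_sig).1. Qed.

Lemma sharp_invK : cancel sharp_inv (sharp j V).
Proof. exact: (svalP inverse_sig).2. Qed.

HB.instance Definition _ := GRing.isZmodMorphism.Build (sec (pre j V)) (sec V)
  sharp_inv (can2_zmod_morphism sharpK sharp_invK).
HB.instance Definition _ := GRing.isMonoidMorphism.Build (sec (pre j V)) (sec V)
  sharp_inv (can2_monoid_morphism sharpK sharp_invK).

End Inverse.

Lemma sharp_inv_res (V W : opens X) (hV : V `<=` range j) (hW : W `<=` range j)
    (h : W `<=` V) (h' : pre j W `<=` pre j V) (s : sec (pre j V)) :
  sharp_inv hW (res h' s) = res h (sharp_inv hV s).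
Proof.
apply: (can_inj (sharpK hW)); rewrite sharp_invK sharp_res sharp_invK.
exact: res_irr.
Qed.

Section Factor.
Variables (T : lrs) (x : mor T X) (hx : range x `<=` range j).

Let lift_sig t : {y | j y = x t}.
Proof. apply: cid.
have [y _ e] : range j (x t) by apply: hx; exists t.
by exists y. Qed.

Let fun_y t : Y := sval (lift_sig t).
Let fun_yE t : j (fun_y t) = x t. Proof. exact: svalP (lift_sig t). Qed.

Let cont_y : continuous fun_y.
Proof.
apply/continuousP => V oV.
rewrite [X in open X](_ : _ = x @^-1` (img (Opens oV))).
  exact: (opensP (pre x (img (Opens oV)))).
apply/seteqP; split=> t; rewrite /preimage /=.
  by move=> Vt; exists (fun_y t) => //; exact: fun_yE.
by move=> [y Vy e]; rewrite (_ : fun_y t = y) //; apply: open_imm_inj;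
  rewrite fun_yE.
Qed.

Let pre_y (V : opens Y) : Defs.preim cont_y V `<=` pre x (img V).
Proof. by move=> t Vt; exists (fun_y t) => //; exact: fun_yE. Qed.

(** To pull a section back along the lift, move it to the open set [img V] of [X] by inverting
    [sharp j], then pull it back along [x]. *)
Let sharp_y (V : opens Y) : {rmorphism sec V -> sec (Defs.preim cont_y V)} :=
  res (@pre_y V) \o (sharp x (img V) \o
    (sharp_inv (@img_range V) \o res (@pre_img V))).

Let sharp_y_res (V W : opens Y) (h : W `<=` V) (s : sec V) :
  sharp_y W (res h s) = res (Defs.preimS (cf := cont_y) h) (sharp_y V s).
Proof.
rewrite /sharp_y /=.
have h' : pre j (img W) `<=` pre j (img V) by move=> y /img_in/h/img_in.
transitivity (res (@pre_y W) (sharp x (img W)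
    (sharp_inv (@img_range W) (res h' (res (@pre_img V) s))))).
  by do 3!congr (_ _); rewrite !res_trans; exact: res_irr.
rewrite (sharp_inv_res (@img_range V) (@img_range W) (imgS h)).
by rewrite sharp_res !res_trans; exact: res_irr.
Qed.

Let sharp_y_local t (V : opens Y) (s : sec V) : opens_set V (fun_y t) ->
  unit_at t (sharp_y V s) -> unit_at (fun_y t) s.
Proof.
move=> Vt /unit_at_res ut; have Vx : opens_set (img V) (x t) by exact: pre_y.
move: ut => /(sharp_local Vx); rewrite -fun_yE => /sharp_unit_at.
by rewrite sharp_invK => /unit_at_res.
Qed.

Let mor_y : mor T Y := @Mor T Y fun_y cont_y sharp_y sharp_y_res sharp_y_local.

Lemma open_factor : exists y : mor T Y, j \oM y = x.
Proof.
exists mor_y; apply: mor_ext => [t|V s U hf hg]; first exact: fun_yE.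
rewrite /= /sharp_y /=.
have -> : sharp_inv (@img_range (pre j V)) (res (@pre_img (pre j V)) (sharp j V
  s))
    = res (@img_pre V) s.
  apply: (can_inj (sharpK (@img_range _))); rewrite sharp_invK sharp_res.
  exact: res_irr.
by rewrite sharp_res !res_trans; exact: res_irr.
Qed.

End Factor.

(** Every section of [Y] over [V] comes from a section of [X] over [img V], so its pullback depends
    only on the composite with [j]. *)
Lemma open_mono (T : lrs) (y z : mor T Y) : j \oM y = j \oM z -> y = z.
Proof.
move=> e; apply: mor_ext => [t|V s U hf hg].
  exact: (open_imm_inj (congr1 (fun m : mor _ _ => m t) e)).
pose s' := sharp_inv (@img_range V) (res (@pre_img V) s).
have lem (w : mor T Y) (hw : U `<=` pre w V)
  (hw' : U `<=` pre (j \oM w) (img V)) :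
    res hw (sharp w V s) = res hw' (sharp (j \oM w) (img V) s').
  by rewrite /= sharp_invK sharp_res !res_trans; exact: res_irr.
have hf' : U `<=` pre (j \oM y) (img V) by move=> t /hf Vt; apply/img_in.
have hg' : U `<=` pre (j \oM z) (img V) by move=> t /hg Vt; apply/img_in.
by rewrite (lem _ _ hf') (lem _ _ hg'); exact: sharp_congr.
Qed.

End OpenImmersion.

(** * Affine charts *)

Section SpecSections.
Variable A : comPzRingType.
Implicit Types (a b c : A) (p : prime_ideal A) (U : opens (prime_ideal A)).

Lemma sec_const_zmod U : zmod_morphism (sec_const U).
Proof.
move=> a b; apply: section_ext => p Up /=; rewrite fracN fracD.
by apply: frac_eq => /=; ring.
Qed.

Lemma sec_const_monoid U : monoid_morphism (sec_const U).
Proof.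
split=> [|a b]; apply: section_ext => p Up /=; first by [].
by rewrite fracM; apply: frac_eq => /=; ring.
Qed.

HB.instance Definition _ U := GRing.isZmodMorphism.Build A (section_of U)
  (sec_const U) (@sec_const_zmod U).
HB.instance Definition _ U := GRing.isMonoidMorphism.Build A (section_of U)
  (sec_const U) (@sec_const_monoid U).

Lemma res_sec_const (U V : opens (prime_ideal A)) (h : V `<=` U) a :
  sec_res h (sec_const U a) = sec_const V a.
Proof. exact: section_ext. Qed.

Lemma frac_mul_denom p a (s : denom p) (t := denom1 p) :
  frac a s * frac (dval s) t = frac a t.
Proof. by rewrite fracM; apply: frac_eq => /=; ring. Qed.

Lemma is_unit_sec_const U b : (forall p, opens_set U p -> ~ p b) ->
  is_unit (sec_const U b).
Proof.
move=> nb.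
have lt : @loc_const A U (fun p Up => frac 1 (Denom (nb p Up))).
  move=> p Up; exists U, 1, b; split=> // q Uq _; exists (nb q Uq).
  exact: frac_eq.
exists (MkSection lt); apply: section_ext => p Up /=.
by rewrite -[RHS]/(frac 1 (denom1 p)) fracM; apply: frac_eq => /=; ring.
Qed.

Lemma basic_open_nbhs p (W : set (prime_ideal A)) : open W -> W p ->
  exists2 a, ~ p a & basic_open a `<=` W.
Proof.
by move=> [E ->] [a Ea pa]; exists a => // q qa; exists a.
Qed.

(** The denominator is cleared, [s b = a] instead of [s = a / b], so that no proof about the prime
    [q] enters the fractions. *)
Lemma section_frac (U : opens (prime_ideal A)) (s : section_of U) p :
  opens_set U p -> exists c a b, [/\ ~ p c, basic_open c `<=` U,
    forall q, basic_open c q -> ~ q b &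
    forall q (Uq : opens_set U q), basic_open c q ->
      s q Uq * frac b (denom1 q) = frac a (denom1 q)].
Proof.
move=> Up; have [W [a [b [Wp sW]]]] := section_loc s Up.
have [c pc hc] := @basic_open_nbhs p (W `&` U) (openI (opensP W) (opensP U))
  (conj Wp Up).
exists c, a, b; split=> // [q /hc[]//|q /hc[Wq Uq]|q Uq /hc[Wq _]].
  by have [] := sW q Uq Wq.
by have [qb ->] := sW q Uq Wq; rewrite (frac_mul_denom a (Denom qb)).
Qed.

End SpecSections.

Section Charts.
Variables (A : comPzRingType) (X : lrs) (j : mor (Spec A) X).
Variable oj : open_immersion j.

Section ChartSection.
Variables (V : opens X) (hV : V `<=` range j).

(** An element of [A] seen as a function on an open subset of [X] inside the chart. *)
Definition chart_sec : {rmorphism A -> sec V} :=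
  sharp_inv oj hV \o (sec_const (pre j V) : {rmorphism A -> _}).

Lemma sharp_chart_sec a : sharp j V (chart_sec a) = sec_const (pre j V) a.
Proof. exact: sharp_invK. Qed.

Lemma is_unit_chart_sec b : (forall p, opens_set V (j p) -> ~ p b) ->
  is_unit (chart_sec b).
Proof.
by move=> nb; exact: (is_unit_rmorph (sharp_inv oj hV)
  (@is_unit_sec_const A (pre j V) b nb)).
Qed.

Lemma chart_sec_unit_at p a : opens_set V (j p) ->
  unit_at (j p) (chart_sec a) <-> ~ p a.
Proof.
move=> Vp; rewrite -(sharp_unit_atE _ Vp) sharp_chart_sec.
rewrite (@Spec_unit_at A p (pre j V) (sec_const (pre j V) a) Vp) /=.
exact: loc_unit.
Qed.

End ChartSection.

Lemma res_chart_sec (V W : opens X) (hV : V `<=` range j) (hW : W `<=` range j)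
    (h : W `<=` V) a :
  res h (chart_sec hV a) = chart_sec hW a.
Proof.
have h' : pre j W `<=` pre j V by move=> p /h.
transitivity (sharp_inv oj hW (res h' (sec_const (pre j V) a : sec (pre j V)))).
  by rewrite (sharp_inv_res oj hV hW h h').
by congr (sharp_inv oj hW _); exact: res_sec_const.
Qed.

(** [section_frac] carried over to [X], on the image [V] of the basic open set of [c]. *)
Lemma chart_frac (p : Spec A) (U : opens X) (s : sec U) : opens_set U (j p) ->
  exists (V : opens X) (hU : V `<=` U) (hV : V `<=` range j) (a b : A),
    [/\ opens_set V (j p), ~ p b, is_unit (chart_sec hV b) &
        res hU s * chart_sec hV b = chart_sec hV a].
Proof.
move=> Up; have [c [a [b [pc hc nb e]]]] := section_frac
  (sharp j U s : section_of _) Up.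
pose V := img oj (Opens (basic_openP c) : opens (Spec A)).
have hU : V `<=` U by move=> _ [q /hc Uq <-].
exists V, hU, (@img_range _ _ _ oj _), a, b; split.
- by apply/img_in.
- exact: nb.
- by apply: is_unit_chart_sec => q /img_in; exact: nb.
- apply: (can_inj (sharpK oj (@img_range _ _ _ oj _))).
  rewrite rmorphM /= !sharp_chart_sec sharp_res; apply: section_ext => q Vq.
  have /= cq := (img_in oj _ _).1 Vq; rewrite -(e q (hU _ Vq) cq) /=.
  congr (sval_at _ _ * _); exact: Prop_irrelevance.
Qed.

End Charts.

(** * Equality of morphisms, tested on charts *)

Section MorExt.
Variables (T Z : lrs) (u v : mor T Z).

Hypothesis uv : forall t : T, exists (A : comPzRingType) (j : mor (Spec A) Z)
  (oj : open_immersion j) (V : opens Z) (hV : V `<=` range j),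
  [/\ opens_set V (u t), opens_set V (v t) & forall a, exists (N : opens T)
    (hu : N `<=` pre u V) (hv : N `<=` pre v V), opens_set N t /\
    res hu (sharp u V (chart_sec oj hV a)) =
    res hv (sharp v V (chart_sec oj hV a))].

(** A prime of the chart is determined by the [a] that are units at it, and pullback both preserves
    and reflects unit germs. *)
Let eq_fun t : u t = v t.
Proof.
have [A [j [oj [V [hV [Vu Vv H]]]]]] := uv t.
have [p _ ep] := hV _ Vu; have [q _ eq] := hV _ Vv.
rewrite -ep -eq; congr (j _); apply: prime_ext => a.
have Vp : opens_set V (j p) by rewrite ep.
have Vq : opens_set V (j q) by rewrite eq.
have : ~ p a <-> ~ q a.
  rewrite -(chart_sec_unit_at oj hV a Vp) -(chart_sec_unit_at oj hV a Vq) ep eq.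
  rewrite -!sharp_unit_atE //; have [N [hu [hv [Nt e]]]] := H a.
  by rewrite -(unit_at_resE hu) // e unit_at_resE.
by move=> [h1 h2]; split=> ?; apply: contrapT => /[dup] ?; [move/h2|move/h1].
Qed.

(** Locally a section is a fraction [a / b] of chart functions. Both pullbacks agree on [a] and [b],
    and the pullback of [b] is a unit, which can be cancelled. *)
Lemma mor_ext_chart : u = v.
Proof.
apply: mor_ext => // V s U hf hg; apply: sec_ext_local => t Ut.
have [A [j [oj [V' [hV' [V'u V'v H]]]]]] := uv t.
have [p _ ep] := hV' _ V'u.
have Vp : opens_set V (j p) by rewrite ep; exact: hf.
have [W [hW [hWj [a [b [Wp pb ub e]]]]]] := chart_frac oj s Vp.
have [Na [hua [hva [Nat ea]]]] := H a; have [Nb [hub [hvb [Nbt eb]]]] := H b.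
have hM : meet W V' `<=` range j by move=> x [_]; exact: hV'.
(* [M] is a neighbourhood of [t] on which the fraction is valid and the pullbacks of [a] and [b]
   agree; by [eq_fun] it lies in the preimage of [meet W V'] under [v] as well. *)
pose M := meet (meet U (meet Na Nb)) (pre u (meet W V')).
have MU : M `<=` U by move=> x [[]].
have Mu : M `<=` pre u (meet W V') by move=> x [].
have Mv : M `<=` pre v (meet W V') by move=> x [] _; rewrite /= eq_fun.
have Mt : opens_set M t by split=> //=; rewrite -ep; split=> //; rewrite ep.
exists M, MU; split=> //; rewrite !res_trans.
have hMV : meet W V' `<=` V by move=> x [/hW].
have e' : res hMV s * chart_sec oj hM b = chart_sec oj hM a.
  have := congr1 (res (@meetSl _ W V')) e.
  rewrite rmorphM res_trans !(res_chart_sec _ _ hM) => <-.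
  by congr (_ * _); exact: res_irr.
have transfer (w : mor T Z) (Mw : M `<=` pre w (meet W V'))
  (h : M `<=` pre w V) :
    res h (sharp w V s) * res Mw (sharp w _ (chart_sec oj hM b)) =
    res Mw (sharp w _ (chart_sec oj hM a)).
  rewrite -e' !rmorphM sharp_res res_trans; congr (_ * _); exact: res_irr.
have agree c (N : opens T) (hu : N `<=` pre u V') (hv : N `<=` pre v V') :
    res hu (sharp u V' (chart_sec oj hV' c)) =
    res hv (sharp v V' (chart_sec oj hV' c)) -> M `<=` N ->
    res Mu (sharp u _ (chart_sec oj hM c)) =
    res Mv (sharp v _ (chart_sec oj hM c)).
  move=> ec MN; rewrite -!(res_chart_sec oj hV' hM (@meetSr _ W V')) !sharp_res.
  rewrite !res_trans; have := congr1 (res MN) ec; rewrite !res_trans => ec'.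
  by apply: etrans (etrans ec' _); exact: res_irr.
have MNa : M `<=` Na by move=> x [[_ []]].
have MNb : M `<=` Nb by move=> x [[_ []]].
have ub' : is_unit (res Mu (sharp u _ (chart_sec oj hM b))).
  apply: is_unit_rmorph; apply: is_unit_rmorph.
  rewrite -(res_chart_sec oj hWj hM (@meetSl _ W V')); exact: is_unit_rmorph.
apply: (is_unit_mulIr ub').
by rewrite transfer [in RHS](agree b _ _ _ eb MNb) transfer (agree a _ _ _ ea
  MNa).
Qed.

End MorExt.

(** Stated for any [h] pointwise equal to the composite, so as to fit ring morphisms built in
    another way, such as evaluations. *)
Lemma Spec_map_comp (A B C : comPzRingType) (f : {rmorphism A -> B})
    (g : {rmorphism B -> C}) (h : {rmorphism A -> C}) :
  h =1 g \o f -> Spec_map f \oM Spec_map g = Spec_map h.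
Proof.
move=> hE; have eq1 (p : prime_ideal C) : comap f (comap g p) = comap h p.
  by apply: prime_ext => a /=; rewrite hE.
apply: mor_ext => [p|V s U hf hg]; first exact: eq1.
apply: section_ext => p Up /=.
have Vp : opens_set V (comap f (comap g p)) := hf p Up.
have Vp' : opens_set V (comap h p) := hg p Up.
have [W [a [b [Wp sW]]]] := section_loc (s : section_of V) Vp.
have Wp' : opens_set W (comap h p) by rewrite -eq1.
have [pb e] := sW _ Vp Wp; have [pb' e'] := sW _ Vp' Wp'.
transitivity (loc_map (loc_map (sval_at (s : section_of V) Vp))).
  by congr (loc_map (loc_map (sval_at s _))); exact: Prop_irrelevance.
transitivity (loc_map (sval_at (s : section_of V) Vp')); last first.
  by congr (loc_map (sval_at s _)); exact: Prop_irrelevance.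
by rewrite e e' !loc_mapE; apply: frac_eq; rewrite /= !hE.
Qed.

Lemma Spec_map_id (A : comPzRingType) (f : {rmorphism A -> A}) :
  f =1 id -> Spec_map f = id_mor (Spec A).
Proof.
move=> fE; rewrite -(Spec_map_section (f := f) (g := f)) => [|a].
  by apply/esym/Spec_map_comp => a /=; rewrite !fE.
by rewrite !fE.
Qed.

(** * Scalars as sections of the structure sheaf *)

Section ScalarSections.
Variable k : comPzRingType.

Definition kconst (X : kscheme k) (V : opens X) (c : k) : sec V :=
  res (fun x _ => I : opens_set (pre (ks_str X) (top (Spec k))) x)
    (sharp (ks_str X) (top _) (sec_const (top (Spec k)) c)).

Lemma sharp_kconst (X Y : kscheme k) (f : kmor X Y) (V : opens Y) (c : k) :
  sharp f V (kconst V c) = kconst (pre f V) c.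
Proof.
rewrite /kconst sharp_res.
have h : pre f V `<=` pre (ks_str Y \oM f) (top (Spec k)) by [].
rewrite -(sharp_congr (sec_const (top (Spec k)) c :
  @sec (Spec k) (top (Spec k))) h (fun x _ => I) (kmor_over f)).
by rewrite /= res_trans; exact: res_irr.
Qed.

Lemma res_kconst (X : kscheme k) (V W : opens X) (h : W `<=` V) (c : k) :
  res h (kconst V c) = kconst W c.
Proof. by rewrite /kconst res_trans; exact: res_irr. Qed.

Lemma kconst_kSpec (A : comPzRingType) (phi : {rmorphism k -> A})
  (V : opens (kSpec phi)) (c : k) : kconst V c = sec_const V (phi c).
Proof.
by apply: section_ext => p Vp /=; rewrite loc_mapE; apply: frac_eq => /=; ring.
Qed.

Lemma chart_sec_kconst (A : comPzRingType) (phi : {rmorphism k -> A})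
    (X : kscheme k) (j : kmor (kSpec phi) X) (oj : open_immersion j)
    (V : opens X) (hV : V `<=` range j) (c : k) :
  chart_sec oj hV (phi c) = kconst V c.
Proof.
by apply: (can_inj (sharpK oj hV)); rewrite sharp_chart_sec sharp_kconst
  kconst_kSpec.
Qed.

End ScalarSections.

(** * Points over a local ring *)

Section LocalBase.
Variables (k : comPzRingType) (hk : local_ring k).

Lemma nonunit0 : ~ is_unit (0 : k).
Proof. by move=> [b]; rewrite mul0r => /esym; exact: hk.1. Qed.

Lemma nonunitD (a b : k) : ~ is_unit a -> ~ is_unit b -> ~ is_unit (a + b).
Proof. by move=> na nb /hk.2[]. Qed.

Lemma nonunitM (a b : k) : ~ is_unit b -> ~ is_unit (a * b).
Proof. by move=> nb /is_unitM[_]. Qed.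

Lemma nonunit_prime (a b : k) : ~ is_unit (a * b) -> ~ is_unit a \/ ~ is_unit b.
Proof.
by move=> nab; apply/not_andP => -[ua ub]; apply: nab; apply/is_unitM.
Qed.

Definition closed_pt : Spec k :=
  @PrimeIdeal k (fun a => ~ is_unit a) nonunit0 nonunitD nonunitM
    (fun n1 => n1 (is_unit1 k)) nonunit_prime.

Lemma closed_ptE (a : k) : ~ closed_pt a <-> is_unit a.
Proof. by split=> [/contrapT|ua]; [|apply]. Qed.

(** A basic open set around the closed point is given by a unit, which lies in no prime. *)
Lemma closed_pt_open (U : set (Spec k)) : open U -> U closed_pt -> U = setT.
Proof.
move=> oU Um; apply/seteqP; split=> // q _.
have [a /closed_ptE[b e] h] := basic_open_nbhs oU Um.
by apply: h => qa; apply: (@pi1 _ q); rewrite -e mulrC; exact: piM.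
Qed.

(** Denominators outside the maximal ideal are already units of [k], so localising at the closed
    point gives back [k]. *)
Lemma locval_sig (x : loc closed_pt) : {c | x = frac c (denom1 closed_pt)}.
Proof.
apply: cid; have [a [s ->]] := fracP x.
have /closed_ptE[t e] := @denomP _ _ s; exists (a * t).
by apply: frac_eq; rewrite /= mulr1 -mulrA (mulrC t) e mulr1.
Qed.

Definition locval (x : loc closed_pt) : k := sval (locval_sig x).

Lemma locvalK (x : loc closed_pt) : frac (locval x) (denom1 closed_pt) = x.
Proof. by rewrite /locval; case: (locval_sig x). Qed.

Lemma frac1_inj : injective (fun c => frac c (denom1 closed_pt)).
Proof.
move=> c d /fracE[u /= e]; have /closed_ptE uu := @denomP _ _ u.
by apply: (is_unit_mulIr uu); rewrite mulrC [RHS]mulrC; move: e; rewrite !mulr1.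
Qed.

Lemma locval_frac (c : k) : locval (frac c (denom1 closed_pt)) = c.
Proof. by apply: frac1_inj; rewrite locvalK. Qed.

Lemma locvalD : {morph locval : x y / x + y}.
Proof.
move=> x y; rewrite -{1}(locvalK x) -{1}(locvalK y) fracD -[RHS]locval_frac.
by congr locval; apply: frac_eq => /=; ring.
Qed.

Lemma locvalM : {morph locval : x y / x * y}.
Proof.
move=> x y; rewrite -{1}(locvalK x) -{1}(locvalK y) fracM -[RHS]locval_frac.
by congr locval; apply: frac_eq => /=; ring.
Qed.

Lemma locval1 : locval 1 = 1.
Proof. by rewrite -[RHS]locval_frac frac1E. Qed.

(** The neighbourhood of the closed point on which a section is one fraction is all of Spec k, and
    the denominator is a unit; hence the section is a constant, read off from its germ there. *)
Lemma Spec_local_section_ext (U : opens (Spec k)) (s t : section_of U)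
    (Um : opens_set U closed_pt) : s _ Um = t _ Um -> s = t.
Proof.
move=> e.
have key (r : section_of U) q (Uq : opens_set U q) :
    r q Uq = frac (locval (r _ Um)) (denom1 q).
  have [W [a [b [Wm rW]]]] := section_loc r Um.
  have Wq : opens_set W q by rewrite (closed_pt_open (opensP W) Wm).
  have [mb em] := rW _ Um Wm; have [qb ->] := rW q Uq Wq.
  have e' : locval (r _ Um) * b = a.
    apply: frac1_inj; rewrite em; move/closed_ptE: (mb) => -[b' eb].
    have -> : frac a (Denom mb) = frac (a * b') (denom1 closed_pt).
      by apply: frac_eq; rewrite /= mulr1 -mulrA (mulrC b') eb mulr1.
    by rewrite locval_frac -mulrA (mulrC b') eb mulr1.
  by apply: frac_eq; rewrite /= e' mulr1.
by apply: section_ext => q Uq; rewrite key e -key.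
Qed.

(** * Values of sections at points with values in k *)

Section Evaluation.
Variables (X : lrs).
Implicit Types (x : mor (Spec k) X) (U V : opens X).

(* junk value 0 if x(m) is not in U *)
Definition ev x U (s : sec U) : k :=
  if pselect (opens_set U (x closed_pt)) is left Ux
  then locval ((sharp x U s : section_of _) closed_pt Ux) else 0.

Lemma evE x U (s : sec U) (Ux : opens_set U (x closed_pt)) :
  ev x s = locval ((sharp x U s : section_of _) closed_pt Ux).
Proof.
rewrite /ev; case: pselect => // Ux'; do 2 congr (_ _); exact: Prop_irrelevance.
Qed.

Lemma ev_res x U V (h : V `<=` U) (s : sec U) : opens_set V (x closed_pt) ->
  ev x (res h s) = ev x s.
Proof.
move=> Vx; rewrite (evE _ Vx) (evE _ (h _ Vx)) sharp_res /=;
  congr (locval (sval_at _ _)).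
exact: Prop_irrelevance.
Qed.

Lemma evD x U (s t : sec U) : opens_set U (x closed_pt) ->
  ev x (s + t) = ev x s + ev x t.
Proof. by move=> Ux; rewrite !(evE _ Ux) rmorphD -locvalD. Qed.

Lemma evM x U (s t : sec U) : opens_set U (x closed_pt) ->
  ev x (s * t) = ev x s * ev x t.
Proof. by move=> Ux; rewrite !(evE _ Ux) rmorphM -locvalM. Qed.

Lemma ev0 x U : opens_set U (x closed_pt) -> ev x (0 : sec U) = 0.
Proof.
by move=> Ux; apply: (@addIr _ (ev x (0 : sec U)));
  rewrite -evD // !add0r.
Qed.

Lemma ev1 x U : opens_set U (x closed_pt) -> ev x (1 : sec U) = 1.
Proof. by move=> Ux; rewrite !(evE _ Ux) rmorph1 -[RHS]locval1. Qed.

(** Morphisms preserve and reflect unit germs, and the stalk at the closed point is [k] by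
    [locvalK]. *)
Lemma is_unit_ev x U (s : sec U) : opens_set U (x closed_pt) ->
  is_unit (ev x s) <-> unit_at (x closed_pt) s.
Proof.
move=> Ux; rewrite -(sharp_unit_atE _ Ux).
rewrite (@Spec_unit_at k closed_pt (pre x U) (sharp x U s) Ux) (evE _ Ux).
rewrite -[X in _ <-> is_unit X]locvalK loc_unit; exact: iff_sym (closed_ptE _).
Qed.

(** A chart around the image of the closed point contains the image of all of Spec k by
    [closed_pt_open]. There [mor_ext_chart] applies, and sections over Spec k are compared at the
    closed point only. *)
Lemma point_mor_ext (x y : mor (Spec k) X) :
  (exists (A : comPzRingType) (j : mor (Spec A) X),
     open_immersion j /\ range j (x closed_pt)) ->
  x closed_pt = y closed_pt ->
  (forall U (s : sec U), opens_set U (x closed_pt) -> ev x s = ev y s) -> x = y.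
Proof.
move=> [A [j [oj jx]]] exy exy'; apply: mor_ext_chart => t.
pose V := img oj (top (Spec A)).
have Vx : opens_set V (x closed_pt) by move: jx => [p _ <-]; exists p.
have Vy : opens_set V (y closed_pt) by rewrite -exy.
have VxT := closed_pt_open (opensP (pre x V)) Vx.
have VyT := closed_pt_open (opensP (pre y V)) Vy.
exists A, j, oj, V, (@img_range _ _ _ oj _).
have Vxt q : opens_set V (x q) by have : opens_set (pre x V) q by rewrite VxT.
have Vyt q : opens_set V (y q) by have : opens_set (pre y V) q by rewrite VyT.
split=> // a; exists (top (Spec k)), (fun q _ => Vxt q), (fun q _ => Vyt q).
split=> //; apply: (@Spec_local_section_ext (top _) _ _ I) => /=.
have := exy' _ (chart_sec oj (@img_range _ _ _ oj _) a) Vx.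
rewrite (evE _ Vx) (evE _ Vy) => /(congr1 (fun c => frac c (denom1 closed_pt))).
rewrite !locvalK => e; apply: etrans (etrans e _); congr (sval_at _ _);
  exact: Prop_irrelevance.
Qed.

End Evaluation.

Lemma ev_comp (X Y : lrs) (f : mor X Y) (x : mor (Spec k) X)
    (V : opens Y) (s : sec V) :
  ev (f \oM x) s = ev x (sharp f V s).
Proof.
rewrite {1}/ev; case: pselect => [Vx|nVx]; last first.
  by rewrite /ev; case: pselect.
rewrite (@evE _ _ (pre f V) _ Vx) /=; congr (locval (sval_at _ _)).
exact: Prop_irrelevance.
Qed.

Section Points.
Variable X : kscheme k.
Implicit Types (x y : rpoints X).

Lemma ev_kconst x (U : opens X) (c : k) : opens_set U (x closed_pt) ->
  ev x (kconst U c) = c.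
Proof.
move=> Ux; rewrite (evE _ Ux) -[RHS]locval_frac; congr locval.
transitivity (sval_at (kconst (X := kbase k) (pre x U) c) Ux) => //.
exact: (congr1 (fun s : section_of (pre x U) =>
  sval_at s Ux) (sharp_kconst x U c)).
Qed.

Lemma rpoints_ext x y : x closed_pt = y closed_pt ->
  (forall (U : opens X) (s : sec U), opens_set U (x closed_pt) ->
    ev x s = ev y s) ->
  x = y.
Proof. by move=> e h; apply/kmor_ext/point_mor_ext => //; exact: ks_scheme. Qed.

End Points.

(** * Points of affine schemes *)

Section AffinePoints.
Variables (A : comPzRingType).

Definition ev_global (r : mor (Spec k) (Spec A)) (a : A) : k :=
  ev r (sec_const (top (Spec A)) a : sec (top (Spec A))).

Lemma ev_global_zmod r : zmod_morphism (ev_global r).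
Proof.
move=> a b; rewrite -[a in RHS](subrK b).
rewrite /ev_global [in RHS]rmorphD /= evD //; ring.
Qed.

Lemma ev_global_monoid r : monoid_morphism (ev_global r).
Proof.
split; first by rewrite /ev_global rmorph1; exact: ev1.
by move=> a b; rewrite /ev_global rmorphM; exact: evM.
Qed.

HB.instance Definition _ r := GRing.isZmodMorphism.Build A k (ev_global r)
  (ev_global_zmod r).
HB.instance Definition _ r := GRing.isMonoidMorphism.Build A k (ev_global r)
  (ev_global_monoid r).

(** Apply the map of localisations induced by [h] to the equation. This is how values of sections on
    affine schemes are computed below. *)
Lemma ev_Spec_map (h : {rmorphism A -> k}) (U : opens (Spec A)) (s : sec U)
    (Up : opens_set U (comap h closed_pt)) (a b : A) :
  (s : section_of U) _ Up * frac b (denom1 _) = frac a (denom1 _) ->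
  ev (Spec_map h) s * h b = h a.
Proof.
move=> e; apply: frac1_inj; rewrite (@evE _ (Spec_map h) U s Up).
transitivity (loc_map ((s : section_of U) _ Up * frac b (denom1 _)));
  last first.
  by rewrite e loc_mapE; apply: frac_eq => /=; rewrite rmorph1.
rewrite loc_mapM loc_mapE -[X in _ = X * _]locvalK fracM.
by apply: frac_eq => /=; rewrite rmorph1; ring.
Qed.

Lemma ev_global_Spec_map (h : {rmorphism A -> k}) : ev_global (Spec_map h) =1 h.
Proof.
move=> a; have := @ev_Spec_map h (top (Spec A)) (sec_const _ a) I a 1.
by rewrite rmorph1 mulr1; apply=> /=; rewrite fracM; apply: frac_eq => /=; ring.
Qed.

Lemma ev_sec_const (r : mor (Spec k) (Spec A)) (D : opens (Spec A)) (a : A) :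
  opens_set D (r closed_pt) -> ev r
    (sec_const D a : @sec (Spec A) D) = ev_global r a.
Proof.
move=> Dr; rewrite -(res_sec_const (@subT (Spec A) D) a).
exact: (@ev_res _ r (top (Spec A)) D (@subT _ D) (sec_const _ a) Dr).
Qed.

(** The image of the closed point is detected by the units among the values, and sections are
    locally fractions of elements of [A]; so the values on [A] determine the morphism. *)
Lemma Spec_map_ev_global (r : mor (Spec k) (Spec A)) :
  Spec_map (ev_global r) = r.
Proof.
have ept : Spec_map (ev_global r) closed_pt = r closed_pt.
  apply: prime_ext => a /=.
  have : is_unit (ev_global r a) <-> ~ (r closed_pt : prime_ideal A) a.
    rewrite is_unit_ev // (@Spec_unit_at A _ (top (Spec A)) (sec_const _ a) I).
    exact: loc_unit.
  by move=> [h1 h2]; split=> [nu|pa /h1]; [apply: contrapT => /h2|].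
apply: point_mor_ext => //; first exact: Spec_is_scheme.
move=> U s Up.
have [c [a [b [pc hc nb e]]]] := section_frac (s : section_of U) Up.
have ub : is_unit (ev_global r b).
  by apply: (closed_ptE _).1; exact: nb _ pc.
apply: (is_unit_mulIr ub); rewrite (ev_Spec_map (e _ Up pc)).
have pc' : basic_open c (r closed_pt : prime_ideal A) by rewrite -ept.
have hcU : opens_set U (r closed_pt) by exact: hc.
pose D := Opens (basic_openP c) : opens (Spec A).
have eD : res (hc : D `<=` U) s * sec_const D b = sec_const D a :> section_of D.
  by apply: section_ext => q Dq /=; exact: e.
have gE d : ev_global r d = ev r (sec_const D d : @sec (Spec A) D).
  by rewrite ev_sec_const.
rewrite -(ev_res (hc : D `<=` U)) // !gE -evM //.
apply: etrans (gE a) _.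
exact (congr1 (fun t : @sec (Spec A) D => ev r t) (esym eD)).
Qed.

End AffinePoints.

Lemma ev_chart_sec (A : comPzRingType) (X : lrs) (j : mor (Spec A) X)
    (oj : open_immersion j) (V : opens X) (hV : V `<=` range j)
    (h : {rmorphism A -> k}) (a : A) :
  opens_set V ((j \oM Spec_map h) closed_pt) ->
  ev (j \oM Spec_map h) (chart_sec oj hV a) = h a.
Proof.
move=> Vh; rewrite ev_comp sharp_chart_sec -[RHS](ev_global_Spec_map h).
exact: (@ev_sec_const A (Spec_map h) (pre j V) a Vh).
Qed.

(* A k-point at x0 amounts to a local homomorphism of k-algebras from the stalk
   at x0 to k, given here by the graph R of the induced maps on sections. *)
Lemma stalk_point (X : kscheme k) (x0 : X)
    (R : forall U : opens X, sec U -> k -> Prop) :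
  (forall (U : opens X) (s : sec U), opens_set U x0 -> exists c, R U s c) ->
  (forall (U : opens X) (s : sec U) (c d : k), R U s c -> R U s d -> c = d) ->
  (forall (U V : opens X) (h : V `<=` U) (s : sec U)
    (c : k), R V (res h s) c -> R U s c) ->
  (forall (U : opens X) (s t : sec U) (c d : k), R U s c -> R U t d ->
    R U (s + t) (c + d)) ->
  (forall (U : opens X) (s t : sec U) (c d : k), R U s c -> R U t d ->
    R U (s * t) (c * d)) ->
  (forall (U : opens X) (c : k), opens_set U x0 -> R U (kconst U c) c) ->
  (forall (U : opens X) (s : sec U) (c : k), R U s c -> is_unit c ->
    unit_at x0 s) ->
  exists x : rpoints X, x closed_pt = x0 /\
    forall (U : opens X) (s : sec U) (c : k), opens_set U x0 -> R U s c ->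
      ev x s = c.
Proof.
move=> Rtot Rfun Rres RD RM Rk Runit.
have [A [j [oj [p _ ep]]]] := @ks_scheme _ X x0.
pose V := img oj (top (Spec A)); have hV : V `<=` range j by exact: img_range.
have Vx : opens_set V x0 by exists p.
have kconst1 (U : opens X) : kconst U 1 = 1 by rewrite /kconst !rmorph1.
(* On the functions of an affine chart around [x0] the graph [R] defines a ring morphism to [k],
   hence a candidate for the point. *)
have /choice[g gR] : forall a : A, exists c, R V (chart_sec oj hV a) c.
  by move=> a; exact: Rtot.
have gD : zmod_morphism g.
  move=> a b; apply: (@addIr _ (g b)); rewrite subrK.
  by apply: (Rfun _ (chart_sec oj hV a)) => //;
    rewrite -[a in chart_sec _ _ a](subrK b) rmorphD; exact: RD.
have gM : monoid_morphism g.
  split=> [|a b]; first by apply: (Rfun V 1);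
    [rewrite -(rmorph1 (chart_sec oj hV)) | rewrite -kconst1; exact: Rk].
  by apply: (Rfun _ (chart_sec oj hV (a * b))) => //; rewrite rmorphM;
    exact: RM.
pose g' : {rmorphism A -> k} := HB.pack g
  (GRing.isZmodMorphism.Build A k g gD) (GRing.isMonoidMorphism.Build A k g gM).
(* [Runit] says that the morphism is local: a chart function has a unit value exactly when it is a
   unit at [x0]. *)
have ept : Spec_map g' closed_pt = p.
  apply: prime_ext => a /=.
  have Vp : opens_set V (j p) by rewrite ep.
  have npa : is_unit (g a) <-> ~ p a.
    rewrite -(chart_sec_unit_at oj hV a Vp) ep; split; first exact: Runit.
    move=> [W [h [Wx [t e]]]].
    have [c Rc] := Rtot _ (res h (chart_sec oj hV a)) Wx.
    have [d Rd] := Rtot _ t Wx.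
    have <- : c = g a by apply: (Rfun _ (chart_sec oj hV a)) => //;
      exact: Rres Rc.
    exists d; apply: (Rfun W 1); first by rewrite -e; exact: RM.
    by rewrite -kconst1; exact: Rk.
  by move: npa => [h1 h2]; split=> [nu|pa /h1]; [apply: contrapT => /h2|].
pose y : mor (Spec k) X := j \oM Spec_map g'.
have ey : y closed_pt = x0 by apply: etrans ep; exact: (congr1 (mor_fun j) ept).
have evy (U : opens X) (s : sec U) c : opens_set U x0 -> R U s c -> ev y s = c.
  move=> Ux Rs; have Up : opens_set U (j p) by rewrite ep.
  have [W [hU [hW [a [b [Wp pb ub e]]]]]] := chart_frac oj s Up.
  have Wy : opens_set W (y closed_pt) by rewrite ey -ep.
  have WV : W `<=` V by move=> x /hW[q _ <-]; exists q.
  have evc d : ev y (chart_sec oj hW d) = g d by exact: ev_chart_sec.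
  have ubk : is_unit (g b) by rewrite -evc; apply/is_unit_ev => //;
    exact: is_unit_unit_at.
  apply: (is_unit_mulIr ubk).
  rewrite -(ev_res hU) // -(evc b) -evM // e !evc.
  have x0W : opens_set W x0 by rewrite -ep.
  have RW d : R W (chart_sec oj hW d) (g d).
    have [c' Rc'] := Rtot W (chart_sec oj hW d) x0W.
    rewrite (_ : g d = c') //; apply: (Rfun _ (chart_sec oj hV d)) => //.
    by apply: (Rres V W WV); rewrite res_chart_sec.
  have [c' Rc'] := Rtot W (res hU s) x0W.
  rewrite (_ : c = c'); last by apply: (Rfun U s) => //; exact: Rres Rc'.
  by apply: (Rfun W (chart_sec oj hW a)) => //; rewrite -e; exact: RM.
(* By [Rk] the value of a scalar is that scalar, so the composite with the structure morphism is the
   spectrum of the identity. *)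
have over : ks_str X \oM y = id_mor (Spec k).
  rewrite -[LHS]Spec_map_ev_global; apply: Spec_map_id => c.
  rewrite /= /ev_global ev_comp -[RHS](evy (top X) (kconst (top X) c)) //;
    last exact: Rk.
  rewrite /kconst; apply/esym; exact: ev_res.
by exists (@KMor k (kbase k) X y over).
Qed.

End LocalBase.

(** * Rings of continuous functions *)

Section ContinuousFunctions.
Variables (k : topComUnitRingType).

Lemma ring_cvgD (T : Type) (F : set_system T) {FF : Filter F}
    (f g : T -> k) (a b : k) :
  f @ F --> a -> g @ F --> b -> (fun t => f t + g t) @ F --> a + b.
Proof.
by move=> fa gb; apply: continuous2_cvg fa gb;
  exact: (@add_continuous k (a, b)).
Qed.

Lemma ring_cvgM (T : Type) (F : set_system T) {FF : Filter F}
    (f g : T -> k) (a b : k) :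
  f @ F --> a -> g @ F --> b -> (fun t => f t * g t) @ F --> a * b.
Proof.
by move=> fa gb; apply: continuous2_cvg fa gb;
  exact: (@mul_continuous k (a, b)).
Qed.

Variable E : topologicalType.

Definition cont_pred : {pred E -> k} := fun f => `[< continuous f >].

Lemma cont_subring_closed : subring_closed cont_pred.
Proof.
split=> [|f g /asboolP cf /asboolP cg|f g /asboolP cf /asboolP cg];
  apply/asboolP => t.
- exact: cvg_cst.
- apply: ring_cvgD; first exact: cf.
  by apply: (continuous_comp (g := -%R)); [exact: cg | exact: opp_continuous].
- by apply: ring_cvgM; [exact: cf | exact: cg].
Qed.

(** The ring [D] of the overview. For empty [E] it is the zero ring. *)
Record cfun := CFun { cfun_val :> E -> k ; cfunP : cfun_val \in cont_pred }.

HB.instance Definition _ := [isSub for cfun_val].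
HB.instance Definition _ := [Choice of cfun by <:].
HB.instance Definition _ :=
  GRing.SubChoice_isSubComPzRing.Build (E ->
    k) cont_pred cfun cont_subring_closed.

Lemma cfun_continuous (f : cfun) : continuous f.
Proof. by apply/asboolP; exact: cfunP f. Qed.

Lemma cfun_ext (f g : cfun) : f =1 g -> f = g.
Proof. by move=> /funext fg; exact: val_inj. Qed.

Definition cfun_of (f : E -> k) (cf : continuous f) : cfun := CFun (asboolT cf).

Section FromMor.
Variables (A : comPzRingType) (h : E -> {rmorphism A -> k}).
Hypothesis ch : forall a, continuous (fun e => h e a).

(** A continuous family of morphisms from [A] to [k], indexed by [E], becomes a single morphism from
    [A] to the ring of functions on [E]. *)
Definition cfun_mor (a : A) : cfun := cfun_of (@ch a).

Lemma cfun_mor_zmod : zmod_morphism cfun_mor.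
Proof. by move=> a b; apply: cfun_ext => e /=; rewrite rmorphB. Qed.

Lemma cfun_mor_monoid : monoid_morphism cfun_mor.
Proof.
by split=> [|a b]; apply: cfun_ext => e /=; rewrite ?rmorph1 ?rmorphM.
Qed.

HB.instance Definition _ := GRing.isZmodMorphism.Build A cfun cfun_mor
  cfun_mor_zmod.
HB.instance Definition _ := GRing.isMonoidMorphism.Build A cfun cfun_mor
  cfun_mor_monoid.

End FromMor.

Definition cfun_cst : {rmorphism k -> cfun} :=
  @cfun_mor k (fun=> idfun) (fun a => @cst_continuous _ _ a).

Section Eval.
Variable e : E.

Definition cfun_eval (f : cfun) : k := f e.

Lemma cfun_eval_zmod : zmod_morphism cfun_eval. Proof. by []. Qed.
Lemma cfun_eval_monoid : monoid_morphism cfun_eval. Proof. by []. Qed.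

HB.instance Definition _ := GRing.isZmodMorphism.Build cfun k cfun_eval
  cfun_eval_zmod.
HB.instance Definition _ := GRing.isMonoidMorphism.Build cfun k cfun_eval
  cfun_eval_monoid.

Lemma cfun_evalK : cancel cfun_cst cfun_eval. Proof. by []. Qed.

Definition cfun_point : khom cfun_cst := KHom cfun_evalK.

End Eval.

End ContinuousFunctions.

(** * Initial topologies and the affine topology on Hom_k(A, k) *)

Section SupInitial.
Variables (S : choiceType) (I : Type) (T : topologicalType) (f : I -> S -> T).

Let sup_initial := sup_topology (fun i =>
  Topological.class (initial_topology (f i))).

Lemma sup_initial_cvg (U : Type) (F : set_system U) {FF : Filter F} (g : U -> S)
    (s : S) :
  (forall i, f i (g u) @[u --> F] --> f i s) -> g @ F --> (s : sup_initial).
Proof.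
move=> cg; apply/cvg_sup => i B [_ [[O oO <-] Oh] OB].
by apply: filterS OB _; apply: (cg i); exact: open_nbhs_nbhs.
Qed.

Lemma sup_initial_continuous i : continuous (f i : sup_initial -> T).
Proof.
apply/continuousP => O oO; rewrite openE => h Oh.
have /cvg_sup/(_ i) : nbhs (h : sup_initial) --> (h : sup_initial) by [].
by apply; exists (f i @^-1` O) => //; split=> //; exists O.
Qed.

End SupInitial.

Section AffineTop.
Variables (k : topComUnitRingType) (A : comPzRingType)
  (phi : {rmorphism k -> A}).

Lemma khom_ext (f g : khom phi) : f =1 g -> f = g.
Proof.
case: f g => [f fK] [g gK] /= fg; have {}fg : f = g by exact: rmorph_ext.
by subst g; congr KHom; exact: Prop_irrelevance.
Qed.

Lemma khom_cvg (T : Type) (F : set_system T) {FF : Filter F} (g : T -> khom phi)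
    (h : khom phi) :
  (forall a, g t a @[t --> F] --> h a) -> g @ F --> h.
Proof. by move=> cg; apply: sup_initial_cvg. Qed.

Lemma khom_eval_continuous (a : A) : continuous (fun h : khom phi => h a).
Proof. exact: (@sup_initial_continuous _ _ _ (fun a => evaluation
  (phi := phi) a) a). Qed.

Lemma khom_continuous (T : topologicalType) (g : T -> khom phi) :
  (forall a, continuous (fun t => g t a)) -> continuous g.
Proof. by move=> cg t; apply: khom_cvg => a; exact: cg. Qed.

End AffineTop.

Lemma cfun_point_continuous (k : topComUnitRingType) (E : topologicalType) :
  continuous (@cfun_point k E).
Proof. by apply: khom_continuous => f; exact: cfun_continuous. Qed.

Lemma open_near (T : topologicalType) (S : set T) :
  (forall x, S x -> exists2 N, open N /\ N x & N `<=` S) -> open S.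
Proof.
move=> H; rewrite openE => x /H[N [oN Nx] NS].
by rewrite /interior /= nbhsE; exists N; [split|].
Qed.

Lemma fine_openE (k : topComUnitRingType) (X : kscheme k)
    (W : set (rpoints X)) :
  open W <-> fine_open W.
Proof. by []. Qed.

Lemma affine_pushE (k : topComUnitRingType) (X : kscheme k) (A : comPzRingType)
    (phi : {rmorphism k -> A}) (alpha : kmor (kSpec phi) X) (h : khom phi) :
  affine_push alpha h = alpha \oM Spec_map h :> mor _ _.
Proof. by []. Qed.

Lemma luh_local (k : topComUnitRingType) :
  local_hausdorff_open_units k -> local_ring k.
Proof. by move=> [+ _ _ _]. Qed.

(** * Open immersions and the fine topology *)

Section FineTop.
Variables (k : topComUnitRingType) (hk : local_hausdorff_open_units k).

Local Notation lk := (luh_local hk).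
Local Notation m := (closed_pt lk).

Lemma unit_open : open [set a : k | is_unit a].
Proof.
have [_ _ + _] := hk; congr (open _); apply/seteqP.
by split=> a /is_unitE.
Qed.

(** The units form an open set, so continuity within this set is continuity at each of its
    points. *)
Lemma inv_cvg (a : k) : is_unit a -> (@GRing.inv k) x @[x --> a] --> a^-1.
Proof.
have [_ _ ou cinv] := hk; move=> /is_unitE ua.
have := ou; move=> /continuous_open_subspace cE; move: cinv; rewrite cE.
by apply; exact/mem_set.
Qed.

Lemma khom_unit_open (A : comPzRingType) (phi : {rmorphism k -> A}) (a : A) :
  open [set h : khom phi | is_unit (h a)].
Proof.
have /continuousP := @khom_eval_continuous k A phi a; apply; exact: unit_open.
Qed.

Lemma cfun_unit (E : topologicalType) (f : cfun k E) :
  (forall e, is_unit (f e)) -> is_unit f.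
Proof.
move=> uf; have cf : continuous (fun e => (f e)^-1).
  by move=> e; apply: continuous_cvg; [exact: inv_cvg | exact: cfun_continuous].
exists (cfun_of cf); apply: cfun_ext => e /=.
by apply: mulrV; exact/is_unitE.
Qed.

(** Conditions on the value of one local function; see [box_filter_cvg] for the sense in which they
    generate the topology. *)
Definition box (X : kscheme k) (U : opens X) (s : sec U) (O : set k) :
  set (rpoints X) := [set x : rpoints X | opens_set U (x m) /\ O (ev lk x s)].

(** Pulled back to Spec A, the function is [h a / h b] on the open set where [h c] is a unit, and
    this is continuous in [h] because inversion is continuous on units. *)
Lemma box_open (X : kscheme k) (U : opens X) (s : sec U) (O : set k) :
  open O -> open (box s O).
Proof.
move=> oO; apply/fine_openE => A phi alpha; apply: open_near => h0 [Uh0 Oh0].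
pose U' : opens (prime_ideal A) := pre alpha U.
pose s' : section_of U' := sharp alpha U s.
have [c [a [b [pc hc nb e]]]] := @section_frac A U' s' (comap h0 m) Uh0.
have cU (h : khom phi) : is_unit (h c) -> opens_set U' (comap h m)
  by move=> uc; exact: hc.
have val (h : khom phi) : is_unit (h c) ->
  ev lk (affine_push alpha h) s = h a * (h b)^-1.
  move=> uc; rewrite affine_pushE ev_comp.
  have ub : is_unit (h b) by apply/(closed_ptE lk)/(nb (comap h m)).
  apply: (is_unit_mulIr ub); rewrite -mulrA mulVr ?mulr1; last exact/is_unitE.
  have pc' : basic_open c (comap h m) by exact/(closed_ptE lk).
  exact (@ev_Spec_map k lk A h U' s' (cU h uc) a b (e _ (cU h uc) pc')).
have uc0 : is_unit (h0 c) by exact/(closed_ptE lk).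
have ub0 : is_unit (h0 b) by apply/(closed_ptE lk)/(nb (comap h0 m)).
have nO : nbhs h0 [set h : khom phi | O (h a * (h b)^-1)].
  have ca := @khom_eval_continuous k A phi a h0.
  have cb := @khom_eval_continuous k A phi b h0.
  have := ring_cvgM ca (continuous_cvg _ (inv_cvg ub0) cb).
  by apply; apply: open_nbhs_nbhs; split=> //; rewrite -val.
move: nO => [N [oN N0] NO].
exists (N `&` [set h : khom phi | is_unit (h c)]).
  by split=> //; apply: openI => //; exact: khom_unit_open.
by move=> h [Nh uc]; split; [exact: cU | rewrite val //; exact: NO].
Qed.

(** Composing a test morphism into [X] with [f] gives a test morphism into [Y]. *)
Lemma push_continuous (X Y : kscheme k) (f : kmor X Y) : continuous (push f).
Proof.
apply/continuousP => O oO; apply/fine_openE => A phi alpha.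
have := (fine_openE _).1 oO A phi (kcomp f alpha).
congr (open _); apply/seteqP; split=> h; rewrite /preimage /=;
  by congr O; apply: kmor_ext => /=; rewrite comp_morA.
Qed.

(** The identity of Spec A is one of the test morphisms. *)
Lemma kpoint_continuous (A : comPzRingType) (phi : {rmorphism k -> A}) :
  continuous (@kpoint k A phi).
Proof.
have over : ks_str (kSpec phi) \oM id_mor (Spec A) = ks_str (kSpec phi)
  by exact: comp_idr.
apply/continuousP => O oO; have := (fine_openE _).1 oO A phi (@KMor _ (kSpec
  phi) (kSpec phi) _ over).
congr (open _); apply/seteqP; split=> h; rewrite /preimage /=;
  by congr O; apply: kmor_ext => /=; rewrite comp_idl.
Qed.

Lemma kpoint_surj (A : comPzRingType) (phi : {rmorphism k -> A})
  (x : rpoints (kSpec phi)) : exists h : khom phi, kpoint h = x.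
Proof.
have hK : cancel phi (ev_global lk x).
  move=> c; rewrite -[RHS](@ev_kconst k lk _ x (top (Spec A)) c I).
  by rewrite kconst_kSpec.
exists (KHom hK); apply: kmor_ext => /=; exact: Spec_map_ev_global.
Qed.

Lemma push_inj (X Y : kscheme k) (j : kmor Y X) : open_immersion j ->
  injective (push j).
Proof.
move=> oj x y /(congr1 (@kmor_mor _ _ _)) e; apply: kmor_ext.
exact (open_mono oj e).
Qed.

Lemma kpoint_inj (A : comPzRingType) (phi : {rmorphism k -> A}) :
  injective (@kpoint k A phi).
Proof.
move=> h h' /(congr1 (@kmor_mor _ _ _)) /= e; apply: khom_ext => a.
by rewrite -(ev_global_Spec_map lk h) -(ev_global_Spec_map lk h') e.
Qed.

Lemma ev_global_continuous (A : comPzRingType) (phi : {rmorphism k -> A})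
    (a : A) :
  continuous (fun x : rpoints (kSpec phi) => ev_global lk x a).
Proof.
apply/continuousP => O oO.
have := box_open (X := kSpec phi) (U := top (Spec A)) (sec_const _ a) oO.
by congr (open _); apply/seteqP; split=> x; [case | split].
Qed.

(** The inverse [rho] of [kpoint] is continuous, its evaluations being the functions [ev_global]. So
    the fine topology of an affine scheme is its affine topology. *)
Lemma kpoint_open (A : comPzRingType) (phi : {rmorphism k -> A})
    (O : set (khom phi)) :
  open O -> open (@kpoint k A phi @` O).
Proof.
pose rho x : khom phi := sval (cid (kpoint_surj x)).
have rhoE x : kpoint (rho x) = x by exact: svalP (cid (kpoint_surj x)).
have : continuous rho.
  apply: khom_continuous => a; suff -> : (fun x => rho x a) = (fun x =>
    ev_global lk x a).
    exact: ev_global_continuous.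
  by apply/funext => x; rewrite -[in RHS](rhoE x) ev_global_Spec_map.
move=> /continuousP/[apply]; congr (open _); apply/seteqP; split=> x.
  by move=> Ox; exists (rho x).
by move=> [h Oh <-]; rewrite /preimage /= (_ : rho _ = h) //;
  apply: kpoint_inj; rewrite rhoE.
Qed.

Lemma affine_push_inj (X : kscheme k) (A : comPzRingType)
    (phi : {rmorphism k -> A}) (j : kmor (kSpec phi) X) :
  open_immersion j -> injective (affine_push j).
Proof. by move=> oj h h' /(push_inj oj); exact: kpoint_inj. Qed.

Lemma kfactor (T X Y : kscheme k) (j : kmor Y X) (x : kmor T X) :
  open_immersion j -> range x `<=` range j -> exists y :
    kmor T Y, kcomp j y = x.
Proof.
move=> oj hx; have [y e] := open_factor oj hx.
have over : ks_str Y \oM y = ks_str T by rewrite -(kmor_over j) -comp_morA e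
  kmor_over.
by exists (KMor over); exact: kmor_ext.
Qed.

(** The preimage of the open subscheme in Spec k is everything once it contains the closed point, so
    the point factors. *)
Lemma range_push (X Y : kscheme k) (j : kmor Y X) (x : rpoints X) :
  open_immersion j -> range (push j) x <-> range j (x m).
Proof.
move=> oj; split=> [[y _ <-]|jx]; first by exists (y m).
have [|y <-] := @kfactor _ _ _ j x oj; last by exists y.
have xm : opens_set (pre x (img oj (top Y))) m by move: jx => [y _ e]; exists y.
have e := closed_pt_open (opensP (pre x (img oj (top Y)))) xm.
move=> _ [q _ <-].
by have : opens_set (pre x (img oj (top Y))) q by rewrite e.
Qed.

(* For an affine chart alpha : Spec A -> X and a point h0 of Spec A mapped
   into Y, take a in A with h0 in D(a) and D(a) mapped into Y.  Instead of
   localising A at a, use the ring of continuous functions on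
   {h | h a is a unit}, in which a becomes invertible. *)
Lemma push_open (X Y : kscheme k) (j : kmor Y X) (W : set (rpoints Y)) :
  open_immersion j -> open W -> open (push j @` W).
Proof.
move=> oj oW; apply/fine_openE => A phi alpha;
  apply: open_near => h0 [w0 Ww0 e0].
have p0 : opens_set (pre alpha (img oj (top Y))) (comap h0 m).
  by exists (w0 m) => //; exact: (congr1 (fun x : rpoints X => x m) e0).
have [a pa ha] := @basic_open_nbhs A (comap h0 m) _ (opensP _) p0.
pose S := [set h : khom phi | is_unit (h a)].
have S0 : S h0 by exact/(closed_ptE lk).
have cev b : continuous (fun h : set_type S => val h b).
  move=> h; apply: (@continuous_comp _ _ _ set_val (fun h : khom phi => h b)).
    exact: initial_continuous.
  exact: khom_eval_continuous.
pose psi : {rmorphism A -> cfun k (set_type S)} := cfun_mor cev.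
have over : ks_str X \oM (alpha \oM Spec_map psi) =
  ks_str (kSpec (cfun_cst k (set_type S))).
  rewrite comp_morA kmor_over; apply: Spec_map_comp => c.
  by apply: cfun_ext => h /=; rewrite khomK.
pose u := @KMor k (kSpec (cfun_cst k (set_type S))) X _ over.
(* [psi a] is a unit of the function ring by [cfun_unit], so Spec of this ring maps into the basic
   open set of [a] and thus into [Y]. *)
have [|beta eb] := @kfactor _ _ _ j u oj.
  move=> _ [q _ <-]; suff : basic_open a (comap psi q) by move=> /ha.
  move=> qa.
  have [b eb] : is_unit (psi a).
    by apply: cfun_unit => h; exact: (set_valP h).
  by apply: (@pi1 _ q); rewrite -eb mulrC; apply: piM.
have key (e : set_type S) :
    push j (affine_push beta (cfun_point k e)) = affine_push alpha (set_val e).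
  apply: kmor_ext; rewrite /= comp_morA.
  have -> : j \oM beta = alpha \oM Spec_map psi
    by exact: (congr1 (@kmor_mor _ _ _) eb).
  by rewrite -comp_morA; congr (_ \oM _); exact: Spec_map_comp.
(* Pulling [W] back along [beta] and then along [cfun_point] gives an open subset of [S], the trace
   of an open [O] on Hom_k(A, k). *)
have oW' := (fine_openE _).1 oW _ _ beta.
have /continuousP/(_ _ oW')[O oO eO] := @cfun_point_continuous k (set_type S).
have WO (e : set_type S) : W (affine_push beta (cfun_point k e)) =
  O (set_val e).
  exact: esym (congr1 (fun B : set _ => B e) eO).
pose e1 h (Sh : S h) : set_type S := exist _ h (mem_set Sh).
exists (O `&` S).
  split; first by apply: openI => //; exact: khom_unit_open.
  split=> //; rewrite -(WO (e1 _ S0)) (_ : affine_push _ _ = w0) //.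
  by apply: (push_inj oj); rewrite key.
move=> h [Oh Sh]; exists (affine_push beta (cfun_point k (e1 h Sh))) => //.
  by rewrite WO.
Qed.

Lemma affine_push_open (X : kscheme k) (A : comPzRingType)
    (phi : {rmorphism k -> A}) (j : kmor (kSpec phi) X) (O : set (khom phi)) :
  open_immersion j -> open O -> open (affine_push j @` O).
Proof.
move=> oj oO; rewrite (_ : _ @` O = push j @` (@kpoint k A phi @` O)).
  by apply: push_open => //; exact: kpoint_open.
apply/seteqP; split=> [_ [h Oh <-]|_ [_ [h Oh <-] <-]]; last by exists h.
by exists (kpoint h) => //; exists h.
Qed.

Lemma open_embedding_push (X Y : kscheme k) (j : kmor Y X) :
  open_immersion j -> open_embedding (push j).
Proof.
move=> oj; split; last first.
  have -> : range (push j) = box (1 : sec (img oj (top Y))) setT.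
    apply/seteqP; split=> x; first by move=> /(range_push x oj) jx; split.
    by move=> [jx _]; apply/(range_push x oj).
  exact: box_open openT.
split=> [|U]; first exact: push_inj.
split=> [oU|[V oV ->]]; last by have /continuousP := @push_continuous _ _ j;
  apply.
exists (push j @` U); first exact: push_open.
by apply/seteqP; split=> x; [exists x | move=> [y Uy /(push_inj oj) <-]].
Qed.

(** By [range_push] a point lies in any chart containing the image of its closed point; then [W] is
    the union of the images of its traces, which are open by [push_open]. *)
Lemma affine_open_cover_topology (X : kscheme k) (I : Type) (U : I -> kscheme k)
    (j : forall i, kmor (U i) X) :
  affine_open_cover j ->
  [set: rpoints X] = \bigcup_i range (push (j i)) /\
  forall W : set (rpoints X),
    open W <-> forall i, open (push (j i) @^-1` W).
Proof.
move=> [_ oj cj].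
have cover (x : rpoints X) : exists i, range (push (j i)) x.
  by have [i jx] := cj (x m); exists i; exact/(range_push x (oj i)).
split; first by apply/seteqP; split=> // x _; have [i] := cover x; exists i.
move=> W; split=> [oW i|oW].
  by have /continuousP := @push_continuous _ _ (j i); apply.
rewrite (_ : W = \bigcup_i (push (j i) @` (push (j i) @^-1` W))).
  by apply: bigcup_open => i _; exact: push_open.
apply/seteqP; split=> [x Wx|_ [i _ [y Wy <-]]//].
by have [i [y _ e]] := cover x; exists i => //; exists y => //;
  rewrite /preimage /= e.
Qed.

End FineTop.

(** * Closed immersions and the fine topology *)

Section Charted.
Variables (k : topComUnitRingType) (hk : local_hausdorff_open_units k).

Local Notation lk := (luh_local hk).
Local Notation m := (closed_pt lk).

(** The boxes around a point form a subbase of its neighbourhoods, phrased with filters. *)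
Definition box_filter_cvg (Y : kscheme k) : Prop :=
  forall (F : set_system (rpoints Y)) (y0 : rpoints Y), Filter F ->
  (forall (U : opens Y) (s : sec U) (O : set k), open O ->
     box hk s O y0 -> F (box hk s O)) -> F --> y0.

Lemma finite_type_chart (X : kscheme k) (x : X) : finite_type X ->
  exists (A : comPzRingType) (phi : {rmorphism k -> A})
    (j : kmor (kSpec phi) X),
    [/\ fg_algebra phi, open_immersion j & range j x].
Proof.
by move=> [n [A [phi [j [fg oj]]]]] /(_ x)[i jx];
  exists (A i), (phi i), (j i).
Qed.

(** Near [y0] the points of [Y] are described by ring morphisms from an affine chart of [X], whose
    evaluations are controlled by boxes. Stated for [Y] open in [X] in order to cover the charts of
    a [strong_atlas], for which no finite type hypothesis is at hand. *)
Lemma open_box_filter_cvg (X Y : kscheme k) (j : kmor Y X) :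
  finite_type X -> open_immersion j -> box_filter_cvg Y.
Proof.
move=> ftX oj F y0 FF HF N [W [oW Wy0] WN]; apply: filterS WN _.
have [A [phi [i [_ oi ix0]]]] := finite_type_chart (push j y0 m) ftX.
have [z0 _ ez0] := (range_push hk (push j y0) oi).2 ix0.
have [h0 eh0] := kpoint_surj hk z0.
have /fine_openE/(_ _ _ i) oW' := push_open hk oj oW.
(* The coordinates of [y] in the chart, with default value [h0] outside it; by [FV] the points
   inside the chart form a set of [F]. *)
pose theta (y : rpoints Y) : khom phi :=
  if pselect (exists h : khom phi, affine_push i h = push j y) is left e
  then sval (cid e) else h0.
pose V := img oi (top (Spec A)).
have thetaE (y : rpoints Y) : opens_set (pre j V) (y m) ->
  affine_push i (theta y) = push j y.
  move=> /(range_push hk (push j y) oi)[z _ ez].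
  have [h eh] := kpoint_surj hk z.
  rewrite /theta; case: pselect => [e|[]]; first exact: svalP (cid e).
  by exists h; rewrite -ez -eh.
have Vy0 : opens_set (pre j V) (y0 m) by exact: ix0.
have FV : F [set y : rpoints Y | opens_set (pre j V) (y m)].
  by apply: filterS (HF _ (1 : sec (pre j V)) setT openT (conj Vy0 I)) => y [].
have thetaV (y : rpoints Y) a : opens_set (pre j V) (y m) ->
    ev lk y (sharp j V (chart_sec oi (@img_range _ _ _ oi _) a)) = theta y a.
  move=> Vy; rewrite -ev_comp -[j \oM y]/(push j y : mor _ _) -(thetaE y Vy).
  apply: ev_chart_sec; rewrite -[_ \oM _]/(affine_push i (theta y) : mor _ _).
  by rewrite thetaE.
have theta0 : theta y0 = h0.
  apply: (affine_push_inj hk oi); rewrite thetaE //.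
  by rewrite -ez0 -eh0.
have ctheta : theta @ F --> h0.
  apply: khom_cvg => a B; rewrite -theta0 nbhsE => -[O [oO Oh] OB].
  pose s := sharp j V (chart_sec oi (@img_range _ _ _ oi _) a).
  have Oy0 : O (ev lk y0 s) by rewrite thetaV.
  have Fs : F (box hk s O) by exact: HF _ s O oO (conj Vy0 Oy0).
  suff : F [set y | B (theta y a)] by [].
  by apply: filterS Fs => y [Vy Oy]; apply: OB; rewrite -thetaV.
have /ctheta : nbhs h0 (affine_push i @^-1` [set push j x | x in W]).
  by apply: open_nbhs_nbhs; split=> //; exists y0 => //; rewrite -ez0 -eh0.
rewrite nbhs_simpl /= => FW.
suff : F W by [].
apply: filterS (filterI FW FV) => y [[w Ww ew] Vy].
by rewrite -(push_inj oj (etrans ew (thetaE y Vy))).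
Qed.

Lemma closed_imm_lift (X Y : lrs) (i : mor Y X) (U : opens Y) (s : sec U)
    (y : Y) :
  closed_immersion i -> opens_set U y ->
  exists (W : opens X) (h : pre i W `<=` U) (t : sec W),
    opens_set W (i y) /\ sharp i W t = res h s.
Proof.
move=> [inj_i ci li] Uy.
have oV : open (~` (i @` (~` U))) by apply/closed_openC/ci;
  exact/open_closedC/opensP.
pose V := Opens oV : opens X.
have hV : pre i V `<=` U.
  by move=> y' Vy'; apply: contrapT => nUy'; apply: Vy'; exists y'.
have Vy : opens_set V (i y) by move=> [y' nUy' /inj_i e]; apply: nUy';
  rewrite e.
have [W [h [t [Wy e]]]] := li V (res hV s) _ Vy.
exists W, (subset_trans (fun y' => h (i y')) hV), t; split=> //.
by rewrite e res_trans; exact: res_irr.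
Qed.

Lemma closed_push_inj (X Y : kscheme k) (i : kmor Y X) :
  closed_immersion i -> injective (push i).
Proof.
move=> ci x y e.
have em : x m = y m.
  have [inj_i _ _] := ci; apply: inj_i.
  exact: (congr1 (fun z : rpoints X => z m) e).
apply: (rpoints_ext (hk := lk)) => // U s Ux.
have [W [h [t [Wx et]]]] := closed_imm_lift s ci Ux.
have Uy : opens_set U (y m) by rewrite -em.
have Wy : opens_set W (i (y m)) by rewrite -em.
rewrite -(@ev_res k lk Y x _ _ h s Wx) -(@ev_res k lk Y y _ _ h s Wy) -et
  -!ev_comp.
by rewrite -[i \oM x]/(push i x : mor _ _) e.
Qed.

Lemma closed_push_embedding (X Y : kscheme k) (i : kmor Y X) :
  box_filter_cvg Y -> closed_immersion i -> embedding (push i).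
Proof.
move=> bY ci; split=> [|U]; first exact: closed_push_inj.
split=> [oU|[V oV ->]]; last by have /continuousP := @push_continuous _ _ _ i;
  apply.
have H (y : rpoints Y) : U y -> exists V : set (rpoints X),
    [/\ open V, V (push i y) & push i @^-1` V `<=` U].
  (* [F] is generated by the preimages of the open neighbourhoods of [push i y]. It contains every
     box around [y], because local functions on [Y] lift to [X]. *)
  move=> Uy; pose F : set_system (rpoints Y) :=
    [set B | exists V, [/\ open V, V (push i y) & push i @^-1` V `<=` B]].
  have FF : Filter F.
    split.
    - by exists setT; split=> //; exact: openT.
    - move=> P Q [V [oV Vy VP]] [V' [oV' Vy' VQ]].
      exists (V `&` V'); split=> //; first exact: openI.
      by move=> z [Vz Vz']; split; [exact: VP | exact: VQ].
    - by move=> P Q PQ [V [oV Vy VP]]; exists V; split=> // z /VP/PQ.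
  have : F --> y.
    apply: bY => W s O oO [Wy Oy].
    have [W' [h [t [W'y et]]]] := closed_imm_lift s ci Wy.
    have bE (z : rpoints Y) : opens_set W' (i (z m)) ->
      ev lk (push i z) t = ev lk z s.
      by move=> Wz; rewrite /= ev_comp et ev_res.
    exists (box hk t O); split; first exact: box_open.
      by split=> //; rewrite bE.
    by move=> z [Wz Oz]; split; [exact (h _ Wz) | rewrite -bE].
  apply; exact: open_nbhs_nbhs.
pose T := {V : set (rpoints X) | open V /\ push i @^-1` V `<=` U}.
exists (\bigcup_(V : T) sval V).
  by apply: bigcup_open => V _; exact: (svalP V).1.
apply/seteqP; split=> y.
  by move=> /H[V [oV Vy VU]]; exists (exist _ V (conj oV VU)).
by move=> [[V [oV VU]] _ Vy]; exact (VU y Vy).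
Qed.

Lemma closed_push_range (X Y : kscheme k) (i : kmor Y X) :
  closed_immersion i -> closed (range (push i)).
Proof.
move=> ci; rewrite -[range _]setCK; apply: open_closedC.
apply: open_near => x nx.
have ev_push (W : opens X) (t : sec W) (y : rpoints Y) :
  ev lk (push i y) t = ev lk y (sharp i W t) by rewrite ev_comp.
(* If [x] maps the closed point outside [Y], the open complement of [Y] separates [x] from the
   image. *)
have [xi|nxi] := pselect (range i (x m)); last first.
  have oC : open (~` range i).
    by apply: closed_openC; have [_ + _] := ci; apply; exact: closedT.
  pose C := Opens oC : opens X.
  exists (box hk (1 : sec C) setT); first by split;
    [exact: box_open openT | split].
  by move=> z [Cz _] [y _ ez]; apply: Cz; rewrite -ez; exists (y m).
(* If a function vanishing on [Y] has a non-zero value at [x], the condition that its value be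
   non-zero separates; it is open as [k] is Hausdorff. *)
have [[W [s [Wx si0 sx]]]|noW] := pselect (exists (W : opens X) (s : sec W),
    [/\ opens_set W (x m), sharp i W s = 0 & ev lk x s <> 0]).
  exists (box hk s (~` [set 0])).
    split=> //; apply: box_open; apply: closed_openC.
    by apply: accessible_closed_set1; apply: hausdorff_accessible; case: hk.
  move=> z [Wz sz] [y _ ez]; apply: sz; rewrite -ez ev_push si0; apply: ev0.
  by move: Wz; rewrite -ez.
(* Otherwise values at [x] depend only on the pullback to [Y], and [stalk_point] yields a point of
   [Y] mapping to [x], a contradiction. *)
have {}noW (W : opens X) (s t : sec W) : opens_set W (x m) ->
    sharp i W s = sharp i W t -> ev lk x s = ev lk x t.
  move=> Wx est; apply: contrapT => nst; apply: noW.
  exists W, (s - t); split=> //; first by rewrite rmorphB est subrr.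
  by move=> e; apply: nst; rewrite -[s](subrK t) evD // e add0r.
have [y0 _ ey0] := xi.
(* The value of a function on [Y] is the value at [x] of a local lift to [X], well defined by
   [noW]. *)
pose R (U : opens Y) (s : sec U) (c : k) := exists (W : opens X)
  (h : pre i W `<=` U)
  (t : sec W), [/\ opens_set W (x m), sharp i W t = res h s & ev lk x t = c].
have pair_lift (U : opens Y) (s t : sec U) c d : R U s c -> R U t d ->
  exists (W : opens X) (h : pre i W `<=` U) (s' t' : sec W),
   [/\ opens_set W (x m), sharp i W s' = res h s /\ sharp i W t' = res h t &
       ev lk x s' = c /\ ev lk x t' = d].
  move=> [W [h [s' [Wx es ec]]]] [W' [h' [t' [Wx' et ed]]]].
  have hM : pre i (meet W W') `<=` U by move=> y [/h].
  exists (meet W W'), hM, (res (@meetSl _ W W') s'), (res (@meetSr _ W W') t').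
  by split=> //; split; rewrite ?ev_res // sharp_res ?es ?et res_trans;
    exact: res_irr.
have [] := @stalk_point k lk Y y0 R.
- move=> U s Uy0; have [W [h [t [Wy et]]]] := closed_imm_lift s ci Uy0.
  by exists (ev lk x t), W, h, t; split=> //; rewrite -ey0.
- move=> U s c d Rc Rd; have [W [h [s' [t' [Wx [es et] [<- <-]]]]]] :=
  pair_lift _ _ _ _ _ Rc Rd.
  by apply: noW => //; rewrite es et.
- move=> U V h s c [W [h' [t [Wx et ec]]]].
  by exists W, (subset_trans h' h), t; split=> //; rewrite et res_trans.
- move=> U s t c d Rc Rd; have [W [h [s' [t' [Wx [es et] [<- <-]]]]]] :=
  pair_lift _ _ _ _ _ Rc Rd.
  by exists W, h, (s' + t'); split=> //; rewrite ?evD // !rmorphD /= es et.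
- move=> U s t c d Rc Rd; have [W [h [s' [t' [Wx [es et] [<- <-]]]]]] :=
  pair_lift _ _ _ _ _ Rc Rd.
  by exists W, h, (s' * t'); split=> //; rewrite ?evM // !rmorphM /= es et.
- move=> U c Uy0; have [W [h [t [Wy et]]]] :=
  closed_imm_lift (kconst U c) ci Uy0.
  have Wx : opens_set W (x m) by rewrite -ey0.
  exists W, h, (kconst W c); split=> //; last exact: ev_kconst.
  by rewrite sharp_kconst res_kconst.
- move=> U s c [W [h [t [Wx et <-]]]] /(@is_unit_ev k lk X x W t Wx).
  by rewrite -ey0 => /sharp_unit_at; rewrite et => /unit_at_res.
move=> y [ym evy]; suff : range (push i) x by [].
exists y => //.
have xm : push i y m = x m by rewrite -ey0 -ym.
apply: (rpoints_ext (hk := lk)) => // U s Ux.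
rewrite ev_push; apply: evy; first by rewrite /= ey0 -xm.
by exists U, (fun _ => id), s; split; rewrite ?res_id // -xm.
Qed.

Lemma closed_embedding_push (X Y : kscheme k) (i : kmor Y X) :
  box_filter_cvg Y -> closed_immersion i -> closed_embedding (push i).
Proof. by split; [exact: closed_push_embedding | exact: closed_push_range]. Qed.

End Charted.

(** * Affine spaces *)

Local Notation mpolyV k i := (mpoly.mpolyX k (mpoly.mnm1 i)).

(** Monomials are products of powers of variables. This reduces claims on polynomials to scalars and
    variables. *)
Lemma mpoly_gen_ind (R : comNzRingType) (n : nat) (Q : mpoly.mpoly n R ->
  Prop) :
  (forall c, Q (mpoly.mpolyC n c)) -> (forall i, Q (mpolyV R i)) ->
  (forall p q, Q p -> Q q -> Q (p + q)) -> (forall p q, Q p -> Q q ->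
    Q (p * q)) ->
  forall p, Q p.
Proof.
move=> QC QX QD QM; apply: mpoly.mpolyind => [|c mn p _ _ Qp].
  by rewrite -(rmorph0 (mpoly.mpolyC n (R := R))); exact: QC.
have Q1 : Q 1 by rewrite -(rmorph1 (mpoly.mpolyC n (R := R))); exact: QC.
apply: QD => //; rewrite -mpoly.mul_mpolyC; apply: (QM) => //.
rewrite mpoly.mpolyXE_id; apply: (big_ind Q) => // i _.
by elim: (mn i) => [//|d IH]; rewrite exprS; exact: QM.
Qed.

Section AffineSpaces.
Variables (k : topComUnitRingType) (hk : local_hausdorff_open_units k).

Local Notation lk := (luh_local hk).
Local Notation m := (closed_pt lk).

(** The inverse takes the value of the coordinate ['X], which is continuous; conversely polynomial
    functions on [k] are continuous. *)
Lemma line_point_homeomorphism :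
  homeomorphism (@line_point k : k -> rpoints (affine_line k)).
Proof.
have lpK : cancel (@line_point k) (fun x => ev_global lk x 'X).
  by move=> c; rewrite ev_global_Spec_map /= /horner_eval hornerX.
have Klp : cancel (fun x : rpoints (affine_line k) =>
  ev_global lk x 'X) (@line_point k).
  move=> x; have [h <-] := kpoint_surj hk x.
  rewrite ev_global_Spec_map; congr kpoint; apply: khom_ext => p /=.
  rewrite /horner_eval; elim/poly_ind: p => [|p c IH]; first
    by rewrite horner0 rmorph0.
  by rewrite hornerMXaddC rmorphD rmorphM /= khomK IH.
split; first exact: Bijective lpK Klp.
  move=> c; apply: (@continuous_comp _ _ _ (@eval_line k) (@kpoint k _ _));
    last first.
    exact: kpoint_continuous.
  apply: khom_continuous => p; rewrite /= /horner_eval.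
  elim/poly_ind: p => [|p d IH].
    rewrite (_ : (fun _ => _) = cst 0); first exact: cst_continuous.
    by apply/funext => u; rewrite horner0.
  rewrite (_ : (fun _ => _) = (fun u => p.[u] * u + d)) => [t|]; last first.
    by apply/funext => u; rewrite hornerMXaddC.
  by apply: ring_cvgD; [apply: ring_cvgM;
    [exact: IH | exact: cvg_id] | exact: cvg_cst].
move=> U oU; have /continuousP/(_ U oU) :=
  @ev_global_continuous k hk _ (@polyC k : {rmorphism k -> {poly k}}) 'X.
congr (open _); apply/seteqP; split=> x.
  by move=> Ux; exists (ev_global lk x 'X).
by move=> [c Uc <-]; rewrite /preimage /= lpK.
Qed.

Variable n : nat.

Lemma space_point_continuous :
  continuous (@space_point k n : {ptws 'I_n -> k} ->
    rpoints (affine_space k n)).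
Proof.
move=> c; apply: (@continuous_comp {ptws 'I_n ->
  k} _ _ (@eval_space k n) (@kpoint k _ _)); last first.
  exact: kpoint_continuous.
apply: khom_continuous => p; rewrite /=.
elim/mpoly_gen_ind: p => [a|i|p q IHp IHq|p q IHp IHq].
- rewrite (_ : (fun _ => _) = cst a); first exact: cst_continuous.
  by apply/funext => u /=; rewrite mpoly.mevalC.
- rewrite (_ : (fun _ => _) = (fun u => u i)).
    exact: (@sup_initial_continuous _ _ _ (fun i (f : 'I_n -> k) => f i) i).
  by apply/funext => u; rewrite mpoly.mevalXU.
- rewrite (_ : (fun _ => _) = (fun u => mpoly.meval u p + mpoly.meval u q)) =>
  [t|]; last first.
    by apply/funext => u; rewrite rmorphD.
  exact: (ring_cvgD (IHp t) (IHq t)).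
- rewrite (_ : (fun _ => _) = (fun u => mpoly.meval u p * mpoly.meval u q)) =>
  [t|]; last first.
    by apply/funext => u; rewrite rmorphM.
  exact: (ring_cvgM (IHp t) (IHq t)).
Qed.

Definition space_coord (x : rpoints (affine_space k n)) : {ptws 'I_n -> k} :=
  fun i => ev_global lk x (mpolyV k i).

Lemma space_coordK : cancel space_coord (@space_point k n).
Proof.
move=> x; have [h <-] := kpoint_surj hk x.
rewrite /space_point; congr kpoint; apply: khom_ext => p /=.
elim/mpoly_gen_ind: p => [a|i|p q IHp IHq|p q IHp IHq].
- by rewrite mpoly.mevalC khomK.
- by rewrite mpoly.mevalXU /space_coord ev_global_Spec_map.
- by rewrite !rmorphD; congr (_ + _); [exact: IHp | exact: IHq].
- by rewrite !rmorphM; congr (_ * _); [exact: IHp | exact: IHq].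
Qed.

Lemma space_pointK : cancel (@space_point k n) space_coord.
Proof.
by move=> c; apply/funext => i; rewrite /space_coord ev_global_Spec_map /=
  mpoly.mevalXU.
Qed.

Lemma space_coord_continuous : continuous space_coord.
Proof.
move=> x; apply: (@sup_initial_cvg _ _ _ (fun i (f : 'I_n -> k) =>
  f i) _ (nbhs x)
  (nbhs_filter x)) => i.
exact: ev_global_continuous.
Qed.

(** [space_point] and [space_coord] are inverse and continuous, so the fine topology on A^n(k) is
    the product topology of k^n. *)
Lemma space_openP (V : set (rpoints (affine_space k n))) :
  open V <-> exists2 O : set {ptws 'I_n ->
    k}, open O & V = @space_point k n @` O.
Proof.
split=> [oV|[O oO ->]].
  exists (@space_point k n @^-1` V).
    by have /continuousP := space_point_continuous; apply.
  apply/seteqP; split=> x; last by move=> [c Vc <-].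
  by exists (space_coord x); rewrite /preimage /= space_coordK.
have /continuousP/(_ O oO) := space_coord_continuous.
congr (open _); apply/seteqP; split=> x; last first.
  by move=> [c Oc <-]; rewrite /preimage /= space_pointK.
by move=> Ox; exists (space_coord x) => //; rewrite space_coordK.
Qed.

End AffineSpaces.

(** * The strong topology *)

Section Strong.
Variables (k : topComUnitRingType) (hk : local_hausdorff_open_units k).

(** The closed immersion [e] induces an embedding into A^n(k), whose topology is that of k^n; the
    box condition on [U] comes from the ambient [X]. *)
Lemma subspace_openP (X U : kscheme k) (n : nat) (j : kmor U X)
    (e : kmor U (affine_space k n)) (W : set (rpoints U)) :
  finite_type X -> open_immersion j -> closed_immersion e ->
  subspace_open e W <-> open W.
Proof.
move=> ftX oj ce; have bU : box_filter_cvg hk U := open_box_filter_cvg ftX oj.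
have [_ ee] := closed_push_embedding bU ce.
split=> [[O oO ->]|/ee[V /(space_openP hk)[O oO ->] ->]]; last by exists O.
by apply/ee; exists (@space_point k n @` O) => //; apply/(space_openP hk);
  exists O.
Qed.

Lemma strong_openP (X : kscheme k) (a : strong_atlas X) (W : set (rpoints X)) :
  finite_type X -> open W <-> strong_open a W.
Proof.
move=> ftX; have [_ ->] := affine_open_cover_topology hk (sa_cover a).
have [_ oj _] := sa_cover a.
by split=> H i; apply/(subspace_openP _ ftX (oj i) (@sa_closed _ _ a i));
  exact: H.
Qed.

(** Used to turn a presentation of a finitely generated algebra into a chart of a [strong_atlas]. *)
Lemma Spec_map_closed_immersion (A B : comPzRingType) (f : {rmorphism A -> B}) :
  set_surj setT setT f -> closed_immersion (Spec_map f).
Proof.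
move=> sf; have {}sf b : exists a, f a = b by have [a _ e] := sf b I; exists a.
have clf C : closed C -> closed (Spec_map f @` C).
  move=> cC; have [E eE] := (zariski_openE (A := B) _).1 (closed_openC cC).
  rewrite -[X in closed X]setCK; apply: open_closedC; apply/zariski_openE.
  (* With [C] = V(E), the image is the set of primes containing the preimage of [E] and of 0;
     adjoining 0 forces them to contain the kernel. *)
  exists (f @^-1` ([set b | E b] `|` [set 0])); apply/seteqP; split=> p.
    move=> nCp; apply: contrapT => np; apply: nCp.
    have ker a b : f a = f b -> (p : prime_ideal A) a -> (p : prime_ideal A) b.
      move=> fab pa; rewrite -[b](subrK a) addrC; apply: piD => //.
      apply: contrapT => npab; apply: np; exists (b - a) => //.
      by right; rewrite /= rmorphB fab subrr.
    (* The image of [p] under [f], a prime ideal because [f] is surjective and [p] contains its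
       kernel. *)
    pose q (b : B) := exists2 a, f a = b & (p : prime_ideal A) a.
    have q0 : q 0 by exists 0; [rewrite rmorph0 | exact: pi0].
    have qD b c : q b -> q c -> q (b + c).
      move=> [a1 <- pa1] [a2 <- pa2]; exists (a1 + a2); first
        by rewrite rmorphD.
      exact: piD.
    have qM b c : q c -> q (b * c).
      move=> [a2 <- pa2]; have [a1 <-] := sf b; exists (a1 * a2); first
        by rewrite rmorphM.
      exact: piM.
    have q1 : ~ q 1.
      by move=> [a fa pa]; apply: (@pi1 _ p); apply: (ker a) => //;
        rewrite rmorph1.
    have qP b c : q (b * c) -> q b \/ q c.
      have [a1 <-] := sf b; have [a2 <-] := sf c;
        rewrite -rmorphM => -[a fa pa].
      have /pi_prime[pa1|pa2] := ker _ _ fa pa; [left|right]; first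
        by exists a1.
      by exists a2.
    exists (PrimeIdeal q0 qD qM q1 qP).
      apply: contrapT => nC; have : (~` C) (PrimeIdeal q0 qD qM q1 qP) by [].
      rewrite eE => -[b Eb qb]; have [a fa] := sf b; apply: np.
      exists a; first by left; rewrite /= fa.
      by move=> pa; apply: qb; exists a.
    apply: prime_ext => a /=; split=> [[a' fa' pa']|pa]; last by exists a.
    exact: ker fa' pa'.
  move=> [a [Ea|fa0] pa] [q Cq eq].
    have : (~` C) q by rewrite eE; exists (f a) => // qa; apply: pa;
      rewrite -eq.
    by [].
  by apply: pa; rewrite -eq /= fa0; exact: pi0.
split.
- move=> p q e; apply: prime_ext => b; have [a <-] := sf b.
  by rewrite -[p (f a)]/((Spec_map f p : prime_ideal A) a) e.
- exact: clf.
- move=> V s p Vp.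
  (* Off the closed image the preimage of a neighbourhood is empty, so 0 is a lift. *)
  have [[q _ eq]|np] := pselect (range (Spec_map f) p); last first.
    have oW : open (V `&` ~` range (Spec_map f)).
      by apply: openI; [exact: opensP | exact/closed_openC/clf/closedT].
    exists (Opens oW), (fun _ => @proj1 _ _), 0; split=> //.
    by apply: section_ext => q [_ []]; exists q.
  have Vq : opens_set (pre (Spec_map f) V) q by have := Vp; rewrite -eq.
  have [c [a [b [qc hc nb e]]]] := section_frac (s : section_of _) Vq.
  (* Near [q] the section is [a / b]; lifting [a], [b], [c] to [A], the fraction [a' / b'] is a lift
     where [b'] and [c'] are invertible. *)
  have [[c' fc'] [a' fa'] [b' fb']] := And3 (sf c) (sf a) (sf b).
  pose W : opens (Spec A) := meet (meet V (Opens (basic_openP b') :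
    opens (Spec A)))
    (Opens (basic_openP c') : opens (Spec A)).
  have hW : W `<=` V by move=> x [[]].
  have [t et] : is_unit (sec_const W b') by apply: is_unit_sec_const => x [[]].
  exists W, hW, (sec_const W a' * t); split.
    by split; [split|]; rewrite // -eq /basic_open /= ?fb' ?fc' //; exact: nb.
  apply: section_ext => x Wx.
  have cx : basic_open c x by move: (Wx) => [_]; rewrite /basic_open /= fc'.
  have bx : is_unit (frac b (denom1 x)) by apply/loc_unit; exact: nb.
  apply: (is_unit_mulIr bx).
  transitivity (frac a (denom1 x)); last first.
    rewrite -(e x (hW _ Wx) cx) /=; congr (sval_at _ _ * _);
      exact: Prop_irrelevance.
  rewrite -fa' -fb'.
  have -> : frac (f b') (denom1 x) =
      (sharp (Spec_map f) W (sec_const W b') : section_of _) x Wx.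
    by rewrite /= loc_mapE; apply: frac_eq => /=; rewrite rmorph1.
  transitivity ((sharp (Spec_map f) W (sec_const W a' * t * sec_const W b') :
    section_of _) x Wx).
    exact (congr1 (fun z : section_of _ => z x Wx)
      (esym (rmorphM (sharp (Spec_map f) W) (sec_const W a' * t) (sec_const W
        b')))).
  rewrite -mulrA (mulrC t) et mulr1 /= loc_mapE; apply: frac_eq => /=.
  by rewrite rmorph1.
Qed.

(** The charts given by [finite_type] embed in affine spaces through the surjections [pi]; so
    comparing with [strong_open] is not vacuous. *)
Lemma strong_atlas_inhabited (X : kscheme k) : finite_type X ->
  inhabited (strong_atlas X).
Proof.
move=> [n [A [phi [j [fg oj cj]]]]].
pose d i := sval (cid (fg i)); have Hd i := svalP (cid (fg i)).
pose pi i := sval (cid (Hd i)); have Hpi i := svalP (cid (Hd i)).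
have over i : ks_str (affine_space k (d i)) \oM Spec_map (pi i) =
  ks_str (kSpec (phi i)).
  by apply: Spec_map_comp => c /=; rewrite (Hpi i).1.
pose emb i := @KMor k (kSpec (phi i)) (affine_space k (d i)) _ (over i).
split; apply: (@StrongAtlas k X 'I_n (fun i => kSpec (phi i)) j d emb).
  split=> // i; exists (A i), (id_mor _), (id_mor _).
  by rewrite comp_idl.
by move=> i; apply: Spec_map_closed_immersion; exact: (Hpi i).2.
Qed.

End Strong.

(** * Fibre products *)

Lemma frac1M (A : comPzRingType) (p : prime_ideal A) (a b : A) :
  frac (a * b) (denom1 p) = frac a (denom1 p) * frac b (denom1 p).
Proof. by rewrite fracM; apply: frac_eq => /=; ring. Qed.

Lemma prod_prime_ideal (A : comPzRingType) (p : prime_ideal A) (I : finType)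
  (c : I -> A) : (forall i, ~ p (c i)) -> ~ p (\prod_i c i).
Proof.
move=> nc; apply: (big_ind (fun x => ~ p x)) => [|x y nx ny|//];
  first exact: pi1.
by move=> /pi_prime[].
Qed.

Lemma common_denominator (A : comPzRingType) (p : prime_ideal A)
    (U : opens (prime_ideal A)) (n : nat) (s : 'I_n -> section_of U) :
  opens_set U p -> exists (a : A) (b : 'I_n -> A),
    [/\ ~ p a, basic_open a `<=` U &
      forall i q (Uq : opens_set U q), basic_open a q ->
        s i q Uq * frac a (denom1 q) = frac (b i) (denom1 q)].
Proof.
move=> Up; have /choice[c /choice[a /choice[b H]]] := fun i =>
  section_frac (s i) Up.
have [c0 pc0 hc0] := basic_open_nbhs (opensP U) Up.
have dvd i : exists r, \prod_i (c i * b i) = r * (c i * b i).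
  by rewrite (bigD1 i) //= mulrC; exists (\prod_(j < n | j != i) (c j * b j)).
have {dvd}/choice[r Hr] := dvd.
(* [r i] is the cofactor of [c i * b i] in the product, and [c0] keeps the basic open set inside [U]
   even if [n] is 0. *)
exists (c0 * \prod_i (c i * b i)), (fun i => c0 * r i * c i * a i); split.
- move=> /pi_prime[//|]; apply: prod_prime_ideal => i; have [pc _ nb _] := H i.
  by move=> /pi_prime[//|]; exact: nb.
- by move=> q nq; apply: hc0 => qc; apply: nq; rewrite mulrC; exact: piM.
- move=> i q Uq nq; have [_ _ _ e] := H i.
  have qc : basic_open (c i) q.
    by move=> qc; apply: nq; rewrite (Hr i); apply/piM/piM; rewrite mulrC;
      exact: piM.
  have -> : c0 * \prod_j (c j * b j) = b i * (c0 * r i * c i)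
    by rewrite (Hr i); ring.
  by rewrite frac1M mulrA e // -frac1M; congr frac; ring.
Qed.

Lemma sharp_Spec_map_frac (A D : comPzRingType) (psi : {rmorphism A ->
  D}) (Z : lrs)
    (u : mor (Spec A) Z) (V : opens Z) (s : sec V) (q : Spec D) (a b : A)
    (Vq : opens_set V (u (comap psi q))) :
  (sharp u V s : section_of _) (comap psi q) Vq * frac a (denom1 _) =
    frac b (denom1 _) ->
  (sharp (u \oM Spec_map psi) V s : section_of _) q Vq * frac (psi a) (denom1 q)
    =
  frac (psi b) (denom1 q).
Proof.
move=> e.
have Ee d : frac (psi d) (denom1 q) = loc_map (frac d (denom1 (comap psi q))).
  by rewrite loc_mapE; apply: frac_eq => /=; rewrite rmorph1.
rewrite !Ee -e loc_mapM; congr (loc_map (sval_at _ _) * _).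
exact: Prop_irrelevance.
Qed.

Lemma bijective_surj_inj (S T : Type) (f : S -> T) :
  injective f -> (forall y, exists x, f x = y) -> bijective f.
Proof.
move=> inj_f /choice[g fg]; exists g => // x; exact/inj_f/fg.
Qed.

Section FibreProduct.
Variables (k : topComUnitRingType) (hk : local_hausdorff_open_units k).
Local Notation lk := (luh_local hk).
Local Notation m := (closed_pt lk).
Variables (X Y Z P : kscheme k) (f : kmor X Z) (g : kmor Y Z)
  (p : kmor P X) (q : kmor P Y).
Hypothesis pb : is_pullback f g p q.

Lemma pullback_points_inj (z z' : rpoints P) :
  push p z = push p z' -> push q z = push q z' -> z = z'.
Proof.
move=> ep eq; have [e H] := pb.
have e' : kcomp f (push p z) = kcomp g (push q z).
  by have /set_mem := fibre_map_proof pb z.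
by have [c [_ uc]] := H _ _ _ e'; rewrite -(uc z) // (uc z').
Qed.

(** Uniqueness and existence in the universal property, tested on Spec k. *)
Lemma fibre_map_bijective : bijective (fibre_map pb).
Proof.
apply: bijective_surj_inj => [z z' /(congr1 set_val) e|[[x y] xy]].
  by apply: pullback_points_inj; [exact: (congr1 fst e) | exact:
    (congr1 snd e)].
have [_ H] := pb; have /set_mem e : (x, y) \in fibre_points f g by [].
have [z [[zx zy] _]] := H _ _ _ e; exists z; apply: val_inj => /=.
by rewrite /push zx zy.
Qed.

Lemma fibre_map_continuous : continuous (fibre_map pb).
Proof.
apply/continuousP => _ [O oO <-].
have : continuous (fun z => (push p z, push q z)).
  move=> z; exact: (cvg_pair (@push_continuous _ _ _ p z) (@push_continuous _ _
    _ q z)).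
by move=> /continuousP; apply.
Qed.

(* Around (h1, h2), the pairs (h, h') in Hom(A, k) x Hom(B, k) with the same
   image in Z(k) form a space E.  The ring D of continuous functions on E
   receives A and B, and plays the role of a localisation of the tensor product
   of A and B over an affine chart C of Z: the two maps from Spec D to Z agree
   because they agree at all points of E on the finitely many generators of C.
     *)
Lemma pullback_local_section (A B : comPzRingType) (phiA : {rmorphism k -> A})
    (phiB : {rmorphism k -> B}) (jA : kmor (kSpec phiA) X)
      (jB : kmor (kSpec phiB) Y)
    (W : set (rpoints P)) (z0 : rpoints P) (h1 : khom phiA) (h2 : khom phiB) :
  finite_type Z -> open W -> W z0 ->
  affine_push jA h1 = push p z0 -> affine_push jB h2 = push q z0 ->
  \forall h \near (h1, h2),
    push f (affine_push jA h.1) = push g (affine_push jB h.2) ->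
    exists z, [/\ W z, push p z = affine_push jA h.1 & push q z =
      affine_push jB h.2].
Proof.
move=> ftZ oW Wz0 e1 e2; pose uA := kcomp f jA; pose uB := kcomp g jB.
have push_uA h : affine_push uA h = push f (affine_push jA h).
  by apply: kmor_ext; rewrite /= comp_morA.
have push_uB h : affine_push uB h = push g (affine_push jB h).
  by apply: kmor_ext; rewrite /= comp_morA.
have e12 : affine_push uA h1 = affine_push uB h2.
  by rewrite push_uA push_uB e1 e2; have /set_mem := fibre_map_proof pb z0.
have [C [phiC [jC [[n [pi [piC pis]]] oC jCz]]]] :=
  finite_type_chart (affine_push uA h1 m) ftZ.
pose V := img oC (top (Spec C)).
have hV : V `<=` range jC by exact: img_range.
pose c i : sec V := chart_sec oC hV (pi (mpolyV k i)).
have VA : opens_set (pre uA V) (comap h1 m) by exact: jCz.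
have VB : opens_set (pre uB V) (comap h2 m).
  by move: jCz; rewrite e12.
(* The generators [c i] pull back to [b i / a] on Spec A and, next, to [b' i / a'] on Spec B. *)
have [a [b [na hA eA]]] := common_denominator (fun i => sharp uA V (c i) :
  section_of _) VA.
have [a' [b' [na' hB eB]]] := common_denominator (fun i => sharp uB V (c i) :
  section_of _) VB.
pose S : set (khom phiA * khom phiB) := [set h : khom phiA * khom phiB
  | [/\ is_unit (h.1 a), is_unit (h.2 a') &
  push f (affine_push jA h.1) = push g (affine_push jB h.2)]].
pose E := set_type S.
have cA x : continuous (fun e : E => (set_val e).1 x).
  move=> e; apply: (@continuous_comp _ _ _ set_val
    (fun h : khom phiA * khom phiB => h.1 x)).
    exact: initial_continuous.
  apply: (@continuous_comp _ _ _ fst (fun h : khom phiA => h x));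
    first exact: cvg_fst.
  exact: khom_eval_continuous.
have cB x : continuous (fun e : E => (set_val e).2 x).
  move=> e; apply: (@continuous_comp _ _ _ set_val
    (fun h : khom phiA * khom phiB => h.2 x)).
    exact: initial_continuous.
  apply: (@continuous_comp _ _ _ snd (fun h : khom phiB => h x));
    first exact: cvg_snd.
  exact: khom_eval_continuous.
pose D := cfun k E.
pose psiA : {rmorphism A -> D} := cfun_mor cA.
pose psiB : {rmorphism B -> D} := cfun_mor cB.
have ES (e : E) : S (set_val e) := set_valP e.
have uaD : is_unit (psiA a) by apply: (cfun_unit hk) => e; have [] := ES e.
have ubD : is_unit (psiB a') by apply: (cfun_unit hk) => e; have [] := ES e.
(* At a point of [E] both fractions are the value of [c i] at the common image in [Z]. *)
have eqD i : psiA (b i) * psiB a' = psiB (b' i) * psiA a.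
  apply: cfun_ext => e; have [ua ua' ee] := ES e.
  set h := (set_val e).1 in ua ee *; set h' := (set_val e).2 in ua' ee *.
  have Ah : basic_open a (comap h m) by exact/(closed_ptE lk).
  have Bh : basic_open a' (comap h' m) by exact/(closed_ptE lk).
  have EA := @ev_Spec_map k lk A h _ _ (hA _ Ah) (b i) a (eA i _ (hA _ Ah) Ah).
  have EB := @ev_Spec_map k lk B h' _ _ (hB _ Bh) (b' i) a' (eB i _ (hB _ Bh)
    Bh).
  have EAB : ev lk (Spec_map h) (sharp uA V (c i)) =
    ev lk (Spec_map h') (sharp uB V (c i)).
    rewrite -!ev_comp -[uA \oM _]/(affine_push uA h :
      mor _ _) push_uA ee -push_uB.
    by [].
  rewrite -[LHS]/(h (b i) * h' a') -[RHS]/(h' (b' i) * h a) -EA -EB EAB; ring.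
have overA : ks_str X \oM (jA \oM Spec_map psiA) =
  ks_str (kSpec (cfun_cst k E)).
  rewrite comp_morA kmor_over; apply: Spec_map_comp => x.
  by apply: cfun_ext => e /=; rewrite khomK.
have overB : ks_str Y \oM (jB \oM Spec_map psiB) =
  ks_str (kSpec (cfun_cst k E)).
  rewrite comp_morA kmor_over; apply: Spec_map_comp => x.
  by apply: cfun_ext => e /=; rewrite khomK.
pose u := @KMor k (kSpec (cfun_cst k E)) X _ overA.
pose v := @KMor k (kSpec (cfun_cst k E)) Y _ overB.
have nD (d : prime_ideal D) x : is_unit x -> ~ d x.
  by move=> [y e] dx; apply: (@pi1 _ d); rewrite -e mulrC; exact: piM.
have dA (d : prime_ideal D) : basic_open a (comap psiA d) by exact: nD.
have dB (d : prime_ideal D) : basic_open a' (comap psiB d) by exact: nD.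
(* By [mor_ext_chart] it suffices to compare functions from [C], and by induction on polynomials
   only scalars and the generators [c i]. *)
have fu_gv : kcomp f u = kcomp g v.
  apply: kmor_ext; apply: mor_ext_chart => t; exists C, jC, oC, V, hV.
  have Vu (d : Spec D) : opens_set V (kcomp f u d) by exact: (hA _ (dA d)).
  have Vv (d : Spec D) : opens_set V (kcomp g v d) by exact: (hB _ (dB d)).
  split=> // x; exists (top (Spec D)), (fun d _ => Vu d), (fun d _ => Vv d);
    split=> //.
  have [x' _ <-] := pis x I.
  elim/mpoly_gen_ind: x' => [x1|i|x1 x2 IH1 IH2|x1 x2 IH1 IH2].
  - rewrite piC chart_sec_kconst !sharp_kconst.
    by rewrite (@res_kconst k (kSpec (cfun_cst k E))) (@res_kconst k (kSpec
      (cfun_cst k E))).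
  - apply: section_ext => d Ud.
    have HA := sharp_Spec_map_frac (eA i _ (hA _ (dA d)) (dA d)).
    have HB := sharp_Spec_map_frac (eB i _ (hB _ (dB d)) (dB d)).
    have uab : is_unit (frac (psiA a * psiB a') (denom1 d)).
      by apply/loc_unit/nD/is_unitM.
    apply: (is_unit_mulIr uab); rewrite {1}frac1M (mulrC (psiA a)) frac1M
      !mulrA.
    transitivity (frac (psiA (b i) * psiB a') (denom1 d)).
      rewrite frac1M -HA; congr (_ * _ * _).
      by congr (loc_map (sval_at _ _)); exact: Prop_irrelevance.
    rewrite eqD frac1M -HB; congr (_ * _ * _).
    by apply: esym; congr (loc_map (sval_at _ _)); exact: Prop_irrelevance.
  - by rewrite !rmorphD IH1 IH2.
  - by rewrite !rmorphM IH1 IH2.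
have [_ /(_ _ _ _ fu_gv)[alpha [[pa qa] _]]] := pb.
have keyA (e : E) : push p (affine_push alpha (cfun_point k e)) =
  affine_push jA (set_val e).1.
  apply: kmor_ext; rewrite /= comp_morA.
  have -> : p \oM alpha = jA \oM Spec_map psiA
    by exact: (congr1 (@kmor_mor _ _ _) pa).
  by rewrite -comp_morA; congr (_ \oM _); exact: Spec_map_comp.
have keyB (e : E) : push q (affine_push alpha (cfun_point k e)) =
  affine_push jB (set_val e).2.
  apply: kmor_ext; rewrite /= comp_morA.
  have -> : q \oM alpha = jB \oM Spec_map psiB
    by exact: (congr1 (@kmor_mor _ _ _) qa).
  by rewrite -comp_morA; congr (_ \oM _); exact: Spec_map_comp.
(* As in [push_open], the pullback of [W] along [alpha] and [cfun_point] is the trace on [E] of an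
   open set [O]. *)
have oW' := (fine_openE _).1 oW _ _ alpha.
have /continuousP/(_ _ oW')[O oO eO] := @cfun_point_continuous k E.
have WO (e : E) : W (affine_push alpha (cfun_point k e)) = O (set_val e).
  exact: esym (congr1 (fun B : set _ => B e) eO).
pose mkE h (Sh : S h) : E := exist _ h (mem_set Sh).
have S12 : S (h1, h2).
  split; [exact/(closed_ptE lk) | exact/(closed_ptE lk) |].
  by rewrite -push_uA e12 push_uB.
have O12 : O (h1, h2).
  rewrite -(WO (mkE _ S12)) (_ : affine_push _ _ = z0) //.
  by apply: pullback_points_inj; rewrite ?keyA ?keyB.
have N1 : nbhs h1 [set h : khom phiA | is_unit (h a)].
  by apply: open_nbhs_nbhs; split; [exact: khom_unit_open
    | exact/(closed_ptE lk)].
have N2 : nbhs h2 [set h : khom phiB | is_unit (h a')].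
  by apply: open_nbhs_nbhs; split; [exact: khom_unit_open
    | exact/(closed_ptE lk)].
have N12 : nbhs (h1, h2) ([set h : khom phiA | is_unit (h a)] `*`
    [set h : khom phiB | is_unit (h a')]).
  by exists ([set h : khom phiA | is_unit (h a)], [set h : khom phiB
    | is_unit (h a')]).
have nO : nbhs (h1, h2) O by exact: open_nbhs_nbhs.
apply: filterS (filterI nO N12) => h [Oh [ua ub]] eh.
have Sh : S h by [].
by exists (affine_push alpha (cfun_point k (mkE h Sh))); rewrite WO keyA keyB.
Qed.

(** Affine charts of [X] and [Y] are open on points, so the product neighbourhood from
    [pullback_local_section] gives an open set of the fibre product inside the image of [W]. *)
Lemma fibre_map_open (W : set (rpoints P)) :
  finite_type X -> finite_type Y -> finite_type Z -> open W ->
  open (fibre_map pb @` W).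
Proof.
move=> ftX ftY ftZ oW; apply: open_near => _ [z0 Wz0 <-].
have [A [phiA [jA [_ oA jAz]]]] := finite_type_chart (push p z0 m) ftX.
have [B [phiB [jB [_ oB jBz]]]] := finite_type_chart (push q z0 m) ftY.
have [x0 _ ex0] := (range_push hk (push p z0) oA).2 jAz.
have [y0 _ ey0] := (range_push hk (push q z0) oB).2 jBz.
have [h1 eh1] := kpoint_surj hk x0; have [h2 eh2] := kpoint_surj hk y0.
have e1 : affine_push jA h1 = push p z0 by rewrite -ex0 -eh1.
have e2 : affine_push jB h2 = push q z0 by rewrite -ey0 -eh2.
have [[T1 T2] [/= [O1 [oO1 O1h] OT1] [O2 [oO2 O2h] OT2]] HT] :=
  pullback_local_section ftZ oW Wz0 e1 e2.
have oG1 := affine_push_open hk oA oO1; have oG2 := affine_push_open hk oB oO2.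
have cfst : continuous (fun e : set_type (fibre_points f g) => (set_val e).1).
  move=> e; apply: continuous_comp; [exact: initial_continuous | exact:
    cvg_fst].
have csnd : continuous (fun e : set_type (fibre_points f g) => (set_val e).2).
  move=> e; apply: continuous_comp; [exact: initial_continuous | exact:
    cvg_snd].
exists ([set e : set_type (fibre_points f g)
  | (affine_push jA @` O1) (set_val e).1 /\
    (affine_push jB @` O2) (set_val e).2]).
  split; last by split; [exists h1 | exists h2].
  apply: openI; first by move/continuousP: cfst; apply.
  by move/continuousP: csnd; apply.
move=> e [[h Oh eh] [h' Oh' eh']].
have /set_mem efg := valP e.
have [|z [Wz zh zh']] := HT (h, h') (conj (OT1 _ Oh) (OT2 _ Oh')).
  by rewrite /= eh eh'.
exists z => //; apply: val_inj; rewrite /= zh zh' /= eh eh'.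
by rewrite -surjective_pairing.
Qed.

Lemma fibre_map_homeomorphism :
  finite_type X -> finite_type Y -> finite_type Z ->
    homeomorphism (fibre_map pb).
Proof.
move=> ftX ftY ftZ; split; [exact: fibre_map_bijective | exact:
  fibre_map_continuous |].
by move=> W; exact: fibre_map_open.
Qed.

End FibreProduct.

Theorem corollary5p3 (k : topComUnitRingType) (hk : local_hausdorff_open_units k) :
  (* the fine and the strong topology coincide *)
  (forall X : kscheme k, finite_type X ->
     inhabited (strong_atlas X) /\
     forall (a : strong_atlas X) (W : set (rpoints X)),
       open W <-> strong_open a W)
  /\
  (* (F1) *)
  (forall (X Y Z P : kscheme k) (f : kmor X Z) (g : kmor Y Z)
     (p : kmor P X) (q : kmor P Y) (h : is_pullback f g p q),
     finite_type X -> finite_type Y -> finite_type Z ->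
     homeomorphism (fibre_map h))
  /\
  (* (F2) *)
  homeomorphism (@line_point k : k -> rpoints (affine_line k))
  /\
  (* (F3) *)
  (forall (X Y : kscheme k) (i : kmor Y X),
     finite_type X -> finite_type Y -> closed_immersion i ->
     closed_embedding (push i))
  /\
  (* (F4) *)
  (forall (X Y : kscheme k) (j : kmor Y X),
     finite_type X -> finite_type Y -> open_immersion j ->
     open_embedding (push j))
  /\
  (* (F5) *)
  (forall (X : kscheme k) (I : Type) (U : I -> kscheme k)
     (j : forall i, kmor (U i) X),
     finite_type X -> affine_open_cover j ->
     [set: rpoints X] = \bigcup_i range (push (j i)) /\
     forall W : set (rpoints X),
       open W <-> forall i, open (push (j i) @^-1` W)).
Proof.
split=> [X ftX|]; first by split; [exact: strong_atlas_inhabited | move=> a W;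
  exact: (strong_openP hk)].
split=> [X Y Z P f g p q h ftX ftY ftZ|];
  first exact: (fibre_map_homeomorphism hk).
split; first exact: line_point_homeomorphism.
split=> [X Y i _ ftY ci|].
  (* [Y] is viewed as an open subscheme of itself through the identity. *)
  have bY : box_filter_cvg hk Y.
    exact: (@open_box_filter_cvg k hk Y Y (KMor (comp_idr (ks_str Y))) ftY
      (id_open_immersion Y)).
  exact: closed_embedding_push bY ci.
split=> [X Y j _ _ oj|]; first exact: (open_embedding_push hk oj).
by move=> X I U j _; exact: (affine_open_cover_topology hk).
Qed.
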